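(* Fix $k\geq 3$ and a finite nonempty set $I\subseteq\mathbb{Z}^+$, and let $t=\max(I)+k-1$. Asymptotically as $n\to\infty$, \[d_k(I,n)=\left(1+O\left(n^{-0.49}\right)\right)\binom{n}{t}f_k(n-t)\int_0^1\varphi_k(x)\int_0^x\sum_{\tau\in\mathcal{D}_k(I,t)}\Phi^t_{\tau(t)}(y)\,\mathrm{d}y\,\mathrm{d}x,\] where the implied constant may depend on $k$ and $I$.
   Context: For $w\in S_n$, $D_k(w)$ is the set of indices $i$ with $1\le i\le n-k+1$ and $w(i)>w(i+1)>\cdots>w(i+k-1)$. $\mathcal{D}_k(I,n)=\{w\in S_n: D_k(w)=I\}$, $d_k(I,n)=|\mathcal{D}_k(I,n)|$, and $f_k(n)=d_k(\emptyset,n)$. The constant $r_k>0$ is the one in the known theorem of Ehrenborg, Kitaev and Perry: for each $k\ge2$ there are real $c_k>0$, $r_k>0$, $0\le\gamma_k<1$ with $f_k(n)=n!\,c_k\,r_k^n(1+O_k(\gamma_k^n))$ (this determines $r_k$ uniquely). Define \[\varphi_k(x)=\frac{1}{r_k}\left(1-\frac{(x/r_k)^{k-1}}{(k-1)!}+\frac{(x/r_k)^k}{k!}-\frac{(x/r_k)^{2k-1}}{(2k-1)!}+\frac{(x/r_k)^{2k}}{(2k)!}-\cdots\right),\] and for $1\le s\le t$ and $y\in[0,1]$, \[\Phi^t_s(y)=\frac{t!}{(s-1)!(t-s)!}y^{s-1}(1-y)^{t-s}.\] *)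

(* Defs.v *)
From HB Require Import structures.
From mathcomp Require Import all_boot all_order all_algebra.
From mathcomp Require Import all_fingroup finmap.
From mathcomp Require Import all_classical all_reals all_analysis.

Set Implicit Arguments.
Unset Strict Implicit.
Unset Printing Implicit Defensive.

Import Order.TTheory GRing.Theory Num.Theory.
Import numFieldNormedType.Exports.

Local Open Scope classical_set_scope.
Local Open Scope ring_scope.

(* The 1-based letter w(i) of w in S_n, while 'S_n permutes {0, ..., n-1};
   the value is 0 when i > n (and i = 0 is never used). *)
Definition letter (n : nat) (w : 'S_n) (i : nat) : nat :=
  if insub i.-1 is Some j then (w j).+1 else 0%N.

(* D_k(w), for k >= 1; [iota 1 (n.+1 - k)] lists 1, ..., n - k + 1 and is
   empty when n < k. *)
Definition descset (k n : nat) (w : 'S_n) : {fset nat} :=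
  [fset i in iota 1 (n.+1 - k)
     | all (fun j => (letter w j.+1 < letter w j)%N) (iota i k.-1)]%fset.

Definition descperms (k : nat) (I : {fset nat}) (n : nat) : {set 'S_n} :=
  [set w : 'S_n | descset k w == I]%SET.

Definition d (k : nat) (I : {fset nat}) (n : nat) : nat := #|descperms k I n|.

Definition f (k n : nat) : nat := d k fset0 n.

(* [r] is the constant r_k of the Ehrenborg-Kitaev-Perry asymptotics. *)
Definition is_EKP_constant (R : realType) (k : nat) (r : R) : Prop :=
  0 < r /\
  exists c gamma : R, [/\ 0 < c, 0 <= gamma, gamma < 1 &
    exists2 e : nat -> R^o,
      e =O_\oo (fun n : nat => gamma ^+ n : R^o) &
      forall n : nat, (f k n)%:R = n`!%:R * c * r ^+ n * (1 + e n)].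

(* For k >= 2, the coefficient of z^m is 1/m! if k divides m, -1/m! if k
   divides m + 1, and 0 otherwise. *)
Definition phi (R : realType) (k : nat) (r x : R) : R :=
  r^-1 * limn (pseries
    (fun m : nat => ((k %| m)%:R - (k %| m.+1)%:R) / m`!%:R) (x / r)).

Definition Phi (R : realType) (t s : nat) (y : R) : R :=
  t`!%:R / ((s.-1)`!%:R * (t - s)`!%:R) * y ^+ s.-1 * (1 - y) ^+ (t - s).

(* Main.v *)
Require Import Defs.
From HB Require Import structures.
From mathcomp Require Import all_boot all_order all_algebra.
From mathcomp Require Import all_fingroup finmap.
From mathcomp Require Import all_classical all_reals all_analysis.
From mathcomp Require Import zify ring lra.

(** Let t = max I + k - 1, the position where the last run of [k] descending
    letters ends, and p_n = f_k(n) / n!.  A word [w] has run set [I] exactly when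
    its first [t] letters have run set [I], its letters after [t] contain no run,
    and there is an ascent at position [t] ([descperms_exact]).  The ascent is the
    only condition linking the two segments, and it is removed by a sieve: if A_j
    counts the words with the prescribed prefix, [j] descents from position [t] on
    and no run afterwards, and C_j those where the descents stop after exactly [j]
    steps, then A_j - C_j = A_(j+1) - C_(j+k) ([desc_run_step]).  Hence C_0 is
    A_0 - A_1 + A_k - A_(k+1) + A_(2k) - ... ([alt_inversion]).  The patterns of two
    complementary segments being equidistributed ([card_segs]), A_j / n! is
    p_(n-t-j) times the weight
      w_j = (sum over tau of 'C(tau(t) - 1 + j, j)) / (t + j)!
    ([desc_run_weight], [sum_desc_ext]).  So d_k(I, n) / n! is exactly the
    convolution of [p] with alt_j w_j ([d_weight]), the signs alt_j being those of
    phi_k up to a shift of the index and a change of sign.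

    The weights decay factorially and p_n = c r^n (1 + O(gam^n)), so that
    d_k(I, n) / n! = c r^(n-t) W + O((r gam)^(n-t)) with W the sum of the series
    alt_j w_j r^-j ([geometric_convolution]).  The same sieve applied to f_k itself
    gives sum_j alt_j p_(n-j) / j! = 0 for n >= 1, whence
    sum_j alt_j r^-j / j! = 0 ([avoid_prob_recurrence], [alt_series_eq0]).

    On the other side, integrating phi_k term by term, and by parts against the
    inner integral, whose moments are Beta integrals, expresses the double integral
    as t! W minus a multiple of that vanishing series ([integral_value]).

    It remains to see that W > 0 unless no permutation of length [t] has run set
    [I] ([W_gt0]).  The sieve gives d_k(I, n) >= A_0 - A_1 for prefixes of any
    length T with run set [I]; if they end with their smallest letter, A_1 / A_0
    tends to 1 / (r (T + 1)), which is less than 1 for large T.  The relative error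
    is thus exponentially small, and a fortiori O(n^-0.49). *)

Set Implicit Arguments.
Unset Strict Implicit.
Unset Printing Implicit Defensive.

Import Order.TTheory GRing.Theory Num.Theory.
Import numFieldNormedType.Exports.

Local Open Scope classical_set_scope.
Local Open Scope ring_scope.

(** * Patterns of segments *)

Lemma letterE n (w : 'S_n) (i : nat) (lt_in : (i < n)%N) :
  letter w i.+1 = (w (Ordinal lt_in)).+1.
Proof. by rewrite /letter /= insubT. Qed.

Lemma letter_ord n (w : 'S_n) (i : 'I_n) : letter w i.+1 = (w i).+1.
Proof. by case: i => i lt_in; rewrite letterE. Qed.

Definition rank b (g : nat -> nat) (i : 'I_b) : nat :=
  #|[pred j : 'I_b | (g j < g i)%N]|.

Lemma rank_lt b g (i : 'I_b) : (rank g i < b)%N.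
Proof.
rewrite -[X in (_ < X)%N]card_ord; apply: proper_card; apply/properP.
by split; [exact: subset_predT | exists i; rewrite ?inE ?ltnn].
Qed.

(** The default value [1] is only met when [g] is not injective on positions
    below [b]; keeping the function total lets segments of a permutation be cut
    out without carrying bounds on their endpoints inside types. *)
Definition standardize b (g : nat -> nat) : 'S_b :=
  insubd (1%g : 'S_b) [ffun i : 'I_b => Ordinal (rank_lt g i)].

Lemma ltn_rank b g (i j : 'I_b) : (rank g i < rank g j)%N = (g i < g j)%N.
Proof.
have sub (x y : 'I_b) : (g x <= g y)%N -> (rank g x <= rank g y)%N.
  move=> le_xy; apply: subset_leq_card; apply/fintype.subsetP => z.
  by rewrite !inE => /leq_trans; apply.
have [lt_ij|le_ji] := ltnP (g i) (g j); last by rewrite ltnNge sub.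
apply: proper_card; apply/properP; split.
  by apply/fintype.subsetP => z; rewrite !inE => /ltn_trans; apply.
by exists i; rewrite !inE ?ltnn.
Qed.

Lemma ltn_standardize b g (i j : 'I_b) : {in gtn b &, injective g} ->
  (standardize b g i < standardize b g j)%N = (g i < g j)%N.
Proof.
move=> g_inj; rewrite -(ltn_rank g) /standardize.
suff E k : insubd (1%g : 'S_b) [ffun i : 'I_b => Ordinal (rank_lt g i)] k
    = Ordinal (rank_lt g k) by rewrite !E.
rewrite -pvalE val_insubd.
case: injectiveP => [_ | []]; first by rewrite ffunE.
move=> x y /=; rewrite !ffunE => /(congr1 val) /= E; apply: val_inj.
apply: (g_inj x y (ltn_ord x) (ltn_ord y)).
by have := ltn_rank g x y; have := ltn_rank g y x; rewrite E ltnn; lia.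
Qed.

(** A permutation is its own standardization: [s i] is the number of values
    below [s i], and [s] being onto, these are the values [s j] with [s j < s i]. *)
Lemma perm_ltn_inj b (s s' : 'S_b) :
  (forall i j, (s i < s j)%N = (s' i < s' j)%N) -> s = s'.
Proof.
have E (u : 'S_b) i : val (u i) = #|[pred j | (u j < u i)%N]|.
  rewrite -[RHS](fintype.card_image (@perm_inj _ u)).
  have -> : #|[seq u x | x in [pred j | (u j < u i)%N]]| = #|[pred j : 'I_b | (j < u i)%N]|.
    apply: eq_card => x; rewrite !inE.
    apply/fintype.imageP/idP => [[y + ->]|lt_x]; rewrite ?inE //.
    by exists (u^-1%g x); rewrite ?inE permKV.
  rewrite -sum1_card /=.
  rewrite (big_ord_narrow (ltnW (ltn_ord (u i)))) /=.
  by rewrite sum1_card card_ord.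
move=> ss'; apply/permP => i; apply: val_inj; rewrite /= (E s) (E s').
by apply: eq_card => j; rewrite !inE ss'.
Qed.

Definition seg b a n (w : 'S_n) : 'S_b := standardize b (fun i => letter w (a + i).+1).

Lemma ltn_seg b a n (w : 'S_n) (i j : 'I_b) : (a + b <= n)%N ->
  (seg b a w i < seg b a w j)%N
  = (letter w (a + i).+1 < letter w (a + j).+1)%N.
Proof.
move=> le_abn; rewrite /seg ltn_standardize // => x y; rewrite !inE => lt_x lt_y.
have lx : (a + x < n)%N by lia.
have ly : (a + y < n)%N by lia.
by rewrite (letterE _ lx) (letterE _ ly) => -[/val_inj/perm_inj[/addnI]].
Qed.

Lemma letter_seg b a n (w : 'S_n) (i j : nat) :
  (a + b <= n)%N -> (i < b)%N -> (j < b)%N ->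
  (letter (seg b a w) i.+1 < letter (seg b a w) j.+1)%N
  = (letter w (a + i).+1 < letter w (a + j).+1)%N.
Proof.
move=> le_abn lti ltj.
by rewrite (letterE _ lti) (letterE _ ltj) ltnS ltn_seg.
Qed.

Lemma segP b a n (w : 'S_n) (s : 'S_b) : (a + b <= n)%N ->
  (forall i j : 'I_b,
     (s i < s j)%N = (letter w (a + i).+1 < letter w (a + j).+1)%N) ->
  seg b a w = s.
Proof. by move=> le_abn H; apply: perm_ltn_inj => i j; rewrite ltn_seg. Qed.

Lemma seg_seg b a b' a' n (w : 'S_n) : (a + b <= b')%N -> (a' + b' <= n)%N ->
  seg b a (seg b' a' w) = seg b (a' + a) w.
Proof.
move=> h h'; apply: segP => // i j.
have lti := ltn_ord i; have ltj := ltn_ord j.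
by rewrite ltn_seg ?letter_seg ?addnA //; lia.
Qed.

Lemma seg_id n (w : 'S_n) : seg n 0 w = w.
Proof. by apply: segP => // i j; rewrite !add0n !letter_ord. Qed.

(** * Equidistribution of the patterns of two complementary segments *)

Section Block.
Variables a b : nat.

(** The Young subgroup 'S_a x 'S_b acting on positions. *)
Definition block_fun (s : 'S_a) (u : 'S_b) (i : 'I_(a + b)) : 'I_(a + b) :=
  match fintype.split i with inl x => lshift b (s x) | inr y => rshift a (u y) end.

Lemma block_fun_inj s u : injective (block_fun s u).
Proof.
move=> i j; rewrite /block_fun.
case: splitP => x xE; case: splitP => y yE => /(congr1 val) /=.
- by move=> /val_inj/perm_inj E; apply: val_inj; rewrite /= xE yE E.
- by move=> E; have := ltn_ord (s x); rewrite E; lia.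
- by move=> E; have := ltn_ord (s y); rewrite -E; lia.
- by move=> /addnI/val_inj/perm_inj E; apply: val_inj; rewrite /= xE yE E.
Qed.

Definition block s u : 'S_(a + b) := perm (@block_fun_inj s u).

Lemma letter_block_l s u (w : 'S_(a + b)) (i : 'I_a) :
  letter (block s u * w)%g i.+1 = letter w (s i).+1.
Proof.
have -> : letter (block s u * w)%g i.+1 = letter (block s u * w)%g (lshift b i).+1 by [].
rewrite letter_ord permM permE /block_fun.
case: splitP => j /= E; last by have := ltn_ord i; lia.
have -> : letter w (s i).+1 = letter w (lshift b (s i)).+1 by [].
by rewrite letter_ord; congr (w (lshift b (s _))).+1; apply: val_inj.
Qed.

Lemma letter_block_r s u (w : 'S_(a + b)) (i : 'I_b) :
  letter (block s u * w)%g (a + i).+1 = letter w (a + u i).+1.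
Proof.
have -> : letter (block s u * w)%g (a + i).+1
  = letter (block s u * w)%g (rshift a i).+1 by [].
rewrite letter_ord permM permE /block_fun.
case: splitP => j /= E; first by have := ltn_ord j; lia.
have -> : letter w (a + u i).+1 = letter w (rshift a (u i)).+1 by [].
rewrite letter_ord; congr (w (rshift a (u _))).+1; apply: val_inj => /=.
by move/addnI: E.
Qed.

Lemma seg_block_l s u (w : 'S_(a + b)) :
  seg a 0 (block s u * w)%g = (s * seg a 0 w)%g.
Proof.
apply: segP => [|i j]; first by rewrite add0n leq_addr.
by rewrite !permM ltn_seg ?add0n ?leq_addr // !letter_block_l.
Qed.

Lemma seg_block_r s u (w : 'S_(a + b)) :
  seg b a (block s u * w)%g = (u * seg b a w)%g.
Proof.
by apply: segP => // i j; rewrite !permM ltn_seg // !letter_block_r.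
Qed.

Definition fiber s u := [set w : 'S_(a + b) | (seg a 0 w == s) && (seg b a w == u)]%SET.

(** Left multiplication by [block s u] permutes 'S_(a + b) and moves the pair of
    patterns by [(s, u)], so no pair is realized more often than another. *)
Lemma card_fiber s u : #|fiber s u| = #|fiber 1%g 1%g|.
Proof.
have le s1 u1 s2 u2 : (#|fiber s1 u1| <= #|fiber (s2 * s1)%g (u2 * u1)%g|)%N.
  rewrite -(card_imset (fiber s1 u1) (mulgI (block s2 u2))).
  apply: subset_leq_card; apply/fintype.subsetP => _ /imsetP[w + ->].
  by rewrite !inE seg_block_l seg_block_r => /andP[/eqP-> /eqP->]; rewrite !eqxx.
apply/eqP; rewrite eqn_leq.
have := le s u s^-1%g u^-1%g; rewrite !mulVg => ->.
by have := le 1%g 1%g s u; rewrite !mulg1 => ->.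
Qed.

(** All pairs of patterns are equally frequent, hence each one occurs
    (a + b)! / (a! b!) times; the common value is read off by summing over all
    pairs. *)
Lemma card_segs (S : {set 'S_a}) (U : {set 'S_b}) :
  #|[set w : 'S_(a + b) | (seg a 0 w \in S) && (seg b a w \in U)]%SET|
  = ('C(a + b, a) * (#|S| * #|U|))%N.
Proof.
have E (S' : {set 'S_a}) (U' : {set 'S_b}) :
  #|[set w : 'S_(a + b) | (seg a 0 w \in S') && (seg b a w \in U')]%SET|
  = (#|S'| * #|U'| * #|fiber 1%g 1%g|)%N.
  rewrite -sum1_card (partition_big (@seg a 0 (a + b)) (mem S')) /=; last first.
    by move=> w; rewrite inE => /andP[].
  rewrite -mulnA -sum_nat_const; apply: eq_bigr => s sS.
  rewrite (partition_big (@seg b a (a + b)) (mem U')) /=; last first.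
    by move=> w; rewrite inE => /andP[/andP[]].
  rewrite -sum_nat_const; apply: eq_bigr => u uU.
  rewrite sum1_card -(card_fiber s u); apply: eq_card => w.
  rewrite inE -topredE /= inE.
  case: eqP => [->|]; last by rewrite andbF.
  by case: eqP => [->|]; rewrite ?andbF // sS uU.
have tot : ((a + b)`! = a`! * b`! * #|fiber 1%g 1%g|)%N.
  have := E [set: _]%SET [set: _]%SET; rewrite !cardsT !card_Sn => <-.
  by rewrite -card_Sn -cardsT; apply: eq_card => w; rewrite !inE.
rewrite E [RHS]mulnC; congr (_ * _)%N.
have := @bin_fact (a + b) a (leq_addr _ _); rewrite addKn tot => /eqP.
by rewrite mulnC eqn_pmul2l ?muln_gt0 ?fact_gt0 // => /eqP->.
Qed.

End Block.

(** * Runs *)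

(** Positions are 1-based, as in [letter] and [descset]. *)
Definition des n (w : 'S_n) i := (letter w i.+1 < letter w i)%N.

Lemma des_seg b a n (w : 'S_n) i : (a + b <= n)%N -> (0 < i < b)%N ->
  des (seg b a w) i = des w (a + i).
Proof.
case: i => // i le_abn /= lt_ib.
by rewrite /des letter_seg ?addnS //; lia.
Qed.

Lemma descsetP k n (w : 'S_n) i :
  reflect [/\ (0 < i)%N, (i + k <= n.+1)%N
     & forall j, (i <= j)%N -> (j.+1 < i + k)%N -> des w j]
    (i \in descset k w).
Proof.
rewrite !inE /= mem_iota; apply: (iffP andP).
  move=> [/andP[i1 i2] /allP H]; split => //; first lia.
  by move=> j h1 h2; apply: H; rewrite mem_iota; lia.
case=> i1 i2 H; split; first lia.
apply/allP => j; rewrite mem_iota => /andP[h1 h2]; apply: H => //; lia.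
Qed.

Lemma descset_seg k b a n (w : 'S_n) i : (a + b <= n)%N -> (0 < i)%N ->
  (i \in descset k (seg b a w)) = (i + k <= b.+1)%N && ((a + i)%N \in descset k w).
Proof.
move=> le_abn i_gt0; apply/descsetP/andP.
  case=> _ le_ik H; split=> //; apply/descsetP; split; try lia.
  move=> j h1 h2; rewrite -(subnKC (_ : a <= j)%N); last lia.
  by rewrite -(@des_seg b) //; [apply: H; lia | lia].
case=> le_ik /descsetP[_ _ H]; split => // j h1 h2.
by rewrite des_seg //; [apply: H; lia | lia].
Qed.

Definition avoids k n (w : 'S_n) := descset k w == fset0.

Lemma avoids_segP k a n (w : 'S_n) : (a <= n)%N ->
  reflect (forall i, (a < i)%N -> i \notin descset k w)
   (avoids k (seg (n - a) a w)).
Proof.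
move=> le_an; apply: (iffP eqP) => [E i lt_ai|H].
  apply/negP => iw.
  have := in_fset0 (i - a)%N; rewrite -E descset_seg ?subnKC ?subn_gt0 //; last lia.
  by rewrite iw andbT => /negP; apply; case/descsetP: iw; lia.
apply/fsetP => i; rewrite in_fset0; apply/negP => /[dup] /descsetP[i_gt0 _ _].
by rewrite descset_seg ?subnKC // => /andP[_]; apply/negP/H; lia.
Qed.

Lemma des_lt_run k n (w : 'S_n) i t : i \in descset k w ->
  (i <= t)%N -> (t.+1 < i + k)%N -> des w t.
Proof. by case/descsetP => _ _; apply. Qed.

(** An ascent at position [a] is crossed by no run, and the letters after [a]
    contain none, so every run lies within the first [a] letters. *)
Lemma descset_glue k a n (w : 'S_n) : (a <= n)%N ->
  ((a < n)%N -> ~~ des w a) -> avoids k (seg (n - a) a w) ->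
  descset k w = descset k (seg a 0 w).
Proof.
move=> le_an Ndes /(avoids_segP _ _ le_an) Nrun; apply/fsetP => i.
have [i0|i_gt0] := posnP i.
  by apply/idP/idP => /descsetP[]; rewrite i0.
rewrite descset_seg // add0n; case: leqP => //= lt_a.
apply/negP => iw; have [_ le_n _] := descsetP _ _ _ iw.
have [lt_ai|le_ia] := ltnP a i; first by have := Nrun _ lt_ai; rewrite iw.
have lt_an : (a < n)%N by lia.
by have /negP := Ndes lt_an; apply; apply: des_lt_run iw _ _; lia.
Qed.

(** * The sieve on the descents that follow a prefix *)

Section Decomposition.
Variables (k t n : nat) (S : {set 'S_t}).
Implicit Types w : 'S_n.

(** Two families linked by a sieve.  [desc_run] constrains the letters before and
    after position [j + t] separately, which makes it easy to count.  It is
    [desc_exact 0], with its ascent after the prefix, that describes d_k(I, n). *)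
Definition desc_run j : {set 'S_n} := [set w : 'S_n |
  [&& (j + t <= n)%N, seg t 0 w \in S, all (des w) (iota t j)
    & avoids k (seg (n - (j + t)) (j + t) w)]]%SET.

Definition desc_exact j : {set 'S_n} :=
  [set w in desc_run j | (j + t < n)%N ==> ~~ des w (j + t)]%SET.

Lemma desc_runP j w : reflect
  [/\ (j + t <= n)%N, seg t 0 w \in S,
     forall i, (t <= i)%N -> (i < j + t)%N -> des w i
   & forall i, (j + t < i)%N -> i \notin descset k w]
  (w \in desc_run j).
Proof.
rewrite inE; apply: (iffP and4P).
  case=> h1 h2 /allP h3 /avoids_segP h4; split => // [i h5 h6|]; last exact: h4.
  by apply: h3; rewrite mem_iota; lia.
case=> h1 h2 h3 h4; split => //; last by apply/avoids_segP.
by apply/allP => i; rewrite mem_iota => h; apply: h3; lia.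
Qed.

Lemma desc_exactP j w : reflect
  [/\ w \in desc_run j & (j + t < n)%N -> ~~ des w (j + t)]
  (w \in desc_exact j).
Proof.
rewrite (_ : (w \in desc_exact j)
  = (w \in desc_run j) && ((j + t < n)%N ==> ~~ des w (j + t))) ?inE //.
by apply: (iffP andP) => -[h1 /implyP h2]; split.
Qed.

Lemma desc_run_gt j : (n < j + t)%N -> desc_run j = finset.set0.
Proof. by move=> h; apply/finset.setP => w; rewrite !inE leqNgt h. Qed.

Lemma desc_exact_gt j : (n < j + t)%N -> desc_exact j = finset.set0.
Proof. by move=> h; apply/finset.setP => w; rewrite !inE leqNgt h. Qed.

(** If one more descent follows, the constraint on the tail may
    be started one letter later; the words thereby gained are those in which the
    letters from position [j + t] on descend exactly [k] times, the next descent
    being excluded by the constraint on the tail. *)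
Lemma desc_run_step j :
  (1 < k)%N -> desc_run j :\: desc_exact j = desc_run j.+1 :\: desc_exact (j + k).
Proof.
move=> k_ge2; apply/finset.setP => w; rewrite !finset.in_setD.
apply/andP/andP => [[NC Rj]|[NC Rj1]].
  have /desc_runP[le_n wS des_j run_j] := Rj.
  have [lt_n des_tj] : (j + t < n)%N /\ des w (j + t).
    move: NC; case: ltnP => [lt_n|le_jt] NC.
      split=> //; apply/negPn/negP => Nd; case/negP: NC.
      by apply/desc_exactP.
    by case/negP: NC; apply/desc_exactP; split => //; lia.
  split; last first.
    apply/desc_runP; split => // [i h1 h2|i h]; last by apply: run_j; lia.
    have [->//|ne] := eqVneq i (j + t)%N; apply: des_j; lia.
  (* [k] descents from position [j + t] would be a run starting right after it. *)
  apply/negP => /desc_exactP[/desc_runP[le_n' _ des_k _] _].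
  have /negP := run_j (j + t).+1 (ltnSn _); apply; apply/descsetP.
  by split=> [||i h1 h2]; [lia | lia | apply: des_k; lia].
have /desc_runP[le_n wS des_j run_j] := Rj1.
split.
  apply/negP => /desc_exactP[_ Nd].
  by have /negP := Nd le_n; apply; apply: des_j; lia.
apply/desc_runP; split => //; [lia | by move=> i h1 h2; apply: des_j; lia |].
move=> i lt_i; have [ne|/eqP Ei] := boolP (i != (j + t).+1).
  by apply: run_j; lia.
apply/negP => iw; case/negP: NC; have [_ le_in des_i] := descsetP _ _ _ iw.
(* A run after position [j + t] must start at [j + t + 1]; with the [j + 1]
   descents already there, it makes [j + k] descents from position [t] on. *)
have des_tk l : (t <= l)%N -> (l < j + k + t)%N -> des w l.
  move=> h1 h2; have [lt_l|le_l] := ltnP l (j.+1 + t); first exact: des_j.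
  by apply: des_i; lia.
apply/desc_exactP; split.
  apply/desc_runP; split => //; first lia.
  by move=> l h; apply: run_j; lia.
move=> lt_n; apply/negP => des_last.
have /negP := run_j (j + t).+2 (ltnSn _); apply; apply/descsetP.
split=> [||l h1 h2]; [lia | lia |].
have [->//|ne] := eqVneq l (j + k + t)%N; apply: des_tk; lia.
Qed.

Lemma desc_exact_sub_run j : desc_exact j \subset desc_run j.
Proof. by apply/fintype.subsetP => w /desc_exactP[]. Qed.

Lemma desc_exact_sub_runS j : (1 < k)%N -> desc_exact (j + k) \subset desc_run j.+1.
Proof.
move=> k_ge2; apply/fintype.subsetP => w /desc_exactP[/desc_runP[le_n wS des_k run_k] Nd].
apply/desc_runP; split => //; [lia | by move=> i h1 h2; apply: des_k; lia|].
move=> i h; have [lt_i|le_i] := ltnP (j + k + t) i; first exact: run_k.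
apply/negP => iw; have [_ le_in _] := descsetP _ _ _ iw.
have lt_n : (j + k + t < n)%N by lia.
by have /negP := Nd lt_n; apply; apply: des_lt_run iw _ _; lia.
Qed.

Lemma card_desc_run_step j : (1 < k)%N ->
  (#|desc_run j| + #|desc_exact (j + k)| = #|desc_run j.+1| + #|desc_exact j|)%N.
Proof.
move=> k_ge2; have := congr1 (fun A : {set _} => #|A|) (desc_run_step j k_ge2).
rewrite !cardsD (finset.setIidPr (desc_exact_sub_run j)).
rewrite (finset.setIidPr (desc_exact_sub_runS j k_ge2)).
have := subset_leq_card (desc_exact_sub_run j).
have := subset_leq_card (desc_exact_sub_runS j k_ge2).
by lia.
Qed.

End Decomposition.

(** * Counting prolongations by descents *)

Section AppendLetter.
Variables (n : nat).
Implicit Types (s : 'S_n) (q : 'I_n.+1).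

(** [q] becomes the last letter and the letters of [s] keep their relative order. *)
Definition append s q : 'S_n.+1 := lift_perm ord_max q s.

Lemma letter_append s q (i : 'I_n) : letter (append s q) i.+1 = (lift q (s i)).+1.
Proof.
have -> : letter (append s q) i.+1 = letter (append s q) (lift ord_max i).+1.
  by rewrite lift_max.
by rewrite letter_ord lift_perm_lift.
Qed.

Lemma letter_append_last s q : letter (append s q) n.+1 = q.+1.
Proof.
have -> : letter (append s q) n.+1 = letter (append s q) (@ord_max n).+1 by [].
by rewrite letter_ord lift_perm_id.
Qed.

Lemma seg_append s q : seg n 0 (append s q) = s.
Proof.
apply: segP => // i j; rewrite !add0n !letter_append /= ltnS.
by rewrite /bump; case: leqP; case: leqP; lia.
Qed.

Lemma append_inj s s' q q' : append s q = append s' q' -> s = s' /\ q = q'.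
Proof.
move=> E; split; first by rewrite -(seg_append s q) E seg_append.
by apply: val_inj; have := letter_append_last s q; rewrite E letter_append_last => -[].
Qed.

Lemma sum_append (T : nmodType) (P : pred 'S_n.+1) (F : 'S_n.+1 -> T) :
  \sum_(v | P v) F v = \sum_s \sum_(q | P (append s q)) F (append s q).
Proof.
have inj : injective (fun x : 'S_n * 'I_n.+1 => append x.1 x.2).
  by move=> [s q] [s' q'] /= /append_inj[-> ->].
rewrite (reindex (fun x : 'S_n * 'I_n.+1 => append x.1 x.2)) /=; last first.
  apply/onW_bij/inj_card_bij => //.
  by rewrite card_prod !card_Sn card_ord factS mulnC.
by rewrite pair_big_dep.
Qed.

End AppendLetter.

Definition lastrank n (v : 'S_n) : nat := (letter v n).-1.

Lemma lastrank_append n (s : 'S_n) q : lastrank (append s q) = q.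
Proof. by rewrite /lastrank letter_append_last. Qed.

Lemma lastrank_lt n (s : 'S_n) : (0 < n)%N -> (lastrank s < n)%N.
Proof. by case: n s => // n s _; rewrite /lastrank (letterE _ (ltnSn n)) /=. Qed.

Lemma des_append_last n (s : 'S_n) q : (0 < n)%N ->
  des (append s q) n = (q <= lastrank s)%N.
Proof.
case: n s q => // n s q _; rewrite /des letter_append_last.
rewrite (letter_append s q ord_max) /= ltnS.
have -> : lastrank s = s ord_max by rewrite /lastrank (letter_ord s ord_max).
by rewrite /bump; case: leqP; lia.
Qed.

Lemma des_append n (s : 'S_n) q i : (0 < i < n)%N -> des (append s q) i = des s i.
Proof. by move=> h; rewrite -[in RHS](seg_append s q) des_seg. Qed.

Lemma sum_binom_col n l i : (l < n)%N ->
  (\sum_(q < n | q <= l) 'C(q + i, i) = 'C(l + i.+1, i.+1))%N.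
Proof.
move=> lt_ln.
rewrite (eq_bigl (fun q : 'I_n => q < l.+1)%N) // (big_ord_narrow lt_ln) /=.
elim: l {lt_ln} => [|l IHl]; first by rewrite big_ord1 add0n !binn.
by rewrite big_ord_recr /= IHl (addnS l.+1 i) binS -addSnnS.
Qed.

Section Extensions.
Variables (t : nat) (S : {set 'S_t}).
Hypothesis t_gt0 : (0 < t)%N.

Definition desc_ext j : {set 'S_(j + t)} :=
  [set v : 'S_(j + t) | (seg t 0 v \in S) && all (des v) (iota t j)]%SET.

Lemma desc_ext_append j (s : 'S_(j + t)) q :
  (append s q \in desc_ext j.+1) = (s \in desc_ext j) && (q <= lastrank s)%N.
Proof.
rewrite !inE -andbA -[in RHS](seg_append s q) seg_seg ?addn0 //; last lia.
have -> : iota t j.+1 = iota t j ++ [:: (j + t)%N].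
  by rewrite -[j.+1]addn1 iotaD /= addnC.
have jt_gt0 : (0 < j + t)%N by lia.
rewrite seg_append all_cat all_seq1 (des_append_last _ _ jt_gt0).
congr (_ && (_ && _)); apply: eq_in_all => i.
rewrite mem_iota => h; have lt_i : (0 < i < j + t)%N by lia.
exact: des_append.
Qed.

(** Appending a last letter that makes a descent replaces the last rank [l] by
    any [q <= l]; the weights 'C(l + i, i) are stable under this operation by the
    hockey-stick identity, which raises [i] by one. *)
Lemma sum_desc_ext j i :
  (\sum_(v in desc_ext j) 'C(lastrank v + i, i)
   = \sum_(v in S) 'C(lastrank v + (j + i), j + i))%N.
Proof.
elim: j i => [|j IHj] i.
  by apply: eq_bigl => v; rewrite inE seg_id andbT.
rewrite [LHS](@sum_append (j + t)%N nat).
rewrite (addSnnS j i) -IHj [RHS]big_mkcond; apply: eq_bigr => s _.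
rewrite (eq_bigl _ _ (desc_ext_append s)) /=.
case: ifP => _ /=; last by rewrite big_pred0.
under eq_bigr do rewrite lastrank_append.
by rewrite sum_binom_col // ltnS ltnW // lastrank_lt //; lia.
Qed.

Lemma card_desc_ext j :
  #|desc_ext j| = (\sum_(v in S) 'C(lastrank v + j, j))%N.
Proof.
have := sum_desc_ext j 0; rewrite addn0 => <-.
by rewrite -sum1_card; apply: eq_bigr => v _; rewrite bin0.
Qed.

End Extensions.

Lemma card_segs_sub a b n (S : {set 'S_a}) (U : {set 'S_b}) : (a + b = n)%N ->
  #|[set w : 'S_n | (seg a 0 w \in S) && (seg b a w \in U)]%SET|
  = ('C(n, a) * (#|S| * #|U|))%N.
Proof. by move=> <-; exact: card_segs. Qed.

Lemma card_desc_run k t n (S : {set 'S_t}) j : (0 < t)%N -> (j + t <= n)%N ->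
  #|desc_run k n S j| = ('C(n, j + t)
    * ((\sum_(v in S) 'C(lastrank v + j, j)) * f k (n - (j + t))))%N.
Proof.
move=> t_gt0 le_n; rewrite -card_desc_ext // /f /d.
rewrite -(card_segs_sub _ _ (subnKC le_n)); apply: eq_card => w.
rewrite !inE le_n /= seg_seg //; last lia.
rewrite addn0 -andbA; congr [&& _, _ & _]; apply: eq_in_all => i.
by rewrite mem_iota => h; rewrite des_seg //; lia.
Qed.

(** * The sets counted, in terms of the sieve *)

Lemma bigmax_in_seq (s : seq nat) : s != [::] -> \max_(i <- s) i \in s.
Proof.
elim: s => // a [|b s] IHs _; first by rewrite big_seq1 mem_seq1.
have {}IHs := IHs isT; rewrite big_cons; set m := \max_(i <- _) i in IHs *.
by rewrite in_cons maxnE; case: (leqP m a) => h; [rewrite (_ : _ == a) //; lia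
  | rewrite subnKC ?IHs ?orbT // ltnW].
Qed.

Lemma avoids_short k n (w : 'S_n) : (n < k)%N -> avoids k w.
Proof.
move=> lt_nk; apply/eqP/fsetP => i; rewrite in_fset0.
by apply/negP => /descsetP[]; lia.
Qed.

(** Only the ascent after the prefix matters: the prefix may be any permutation
    with run set [I], possibly much longer than needed to contain the runs. *)
Lemma desc_exact0_sub k (I : {fset nat}) T n (S : {set 'S_T}) :
  S \subset descperms k I T -> desc_exact k n S 0 \subset descperms k I n.
Proof.
move=> /fintype.subsetP SI; apply/fintype.subsetP => w /desc_exactP[].
rewrite !inE add0n => /and4P[le_n /SI + _ avoid] Nd.
by rewrite inE => /eqP <-; rewrite (descset_glue le_n).
Qed.

(** The last run ends at position t = max I + k - 1, so a descent at [t] would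
    create a run starting at max I + 1. *)
Lemma descperms_exact k (I : {fset nat}) n : (1 < k)%N -> I != fset0 ->
  (forall i, i \in I -> (0 < i)%N) ->
  let t := (\max_(i <- I) i + k - 1)%N in (t <= n)%N ->
  descperms k I n = desc_exact k n (descperms k I t) 0.
Proof.
move=> k_gt1 I_neq0 I_gt0 t le_tn.
have le_max i : i \in I -> (i <= \max_(i <- I) i)%N.
  by move=> iI; apply: (leq_bigmax_seq (F := id)).
have max_in : \max_(i <- I) i \in I.
  apply: bigmax_in_seq; apply: contraNneq I_neq0 => I0.
  by apply/eqP/fsetP => i; rewrite in_fset0 -[LHS]/(i \in (I : seq nat)) I0.
have max_gt0 := I_gt0 _ max_in.
apply/eqP; rewrite finset.eqEsubset desc_exact0_sub // andbT.
apply/fintype.subsetP => w; rewrite inE => /eqP wI.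
apply/desc_exactP; rewrite add0n; split.
  apply/desc_runP; split => //; [|by move=> i; lia|].
    rewrite inE; apply/eqP/fsetP => i.
    have [i0|i_gt0] := posnP i.
      rewrite i0; apply/idP/idP => [/descsetP[]//|/I_gt0]//.
    rewrite descset_seg // add0n wI; case iI: (i \in I); rewrite ?andbF // andbT.
    by have := le_max _ iI; rewrite /t; lia.
  move=> i; rewrite add0n wI => h; apply/negP => /le_max.
  by move: h; rewrite /t; lia.
move=> lt_tn; apply/negP => des_t.
suff : (\max_(i <- I) i).+1 \in descset k w by rewrite wI => /le_max; rewrite ltnn.
have max_w : \max_(i <- I) i \in descset k w by rewrite wI.
have [_ _ des_max] := descsetP _ _ _ max_w.
apply/descsetP; split => //; first by rewrite /t in lt_tn; lia.
move=> j h1 h2; have [->//|ne] := eqVneq j t.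
by apply: des_max; rewrite /t in ne *; lia.
Qed.

Lemma card_desc_exact0_ge k T n (S : {set 'S_T}) : (1 < k)%N ->
  (#|desc_run k n S 0| <= #|desc_exact k n S 0| + #|desc_run k n S 1|)%N.
Proof. by move=> k_gt1; have := @card_desc_run_step k T n S 0 k_gt1; lia. Qed.

(** A word whose letters from the second one on contain no run either has no
    run, or its only run starts at the first letter and has exactly [k] letters. *)
Lemma card_avoids k n : (1 < k)%N -> (0 < n)%N ->
  (f k n + #|desc_exact k n [set: 'S_1]%SET k.-1|
   = #|desc_run k n [set: 'S_1]%SET 0|)%N.
Proof.
move=> k_gt1 n_gt0; rewrite /f /d.
have sub : desc_exact k n [set: 'S_1]%SET k.-1 \subset desc_run k n [set: 'S_1]%SET 0.
  apply/fintype.subsetP => w /desc_exactP[/desc_runP[le_n _ des_k run_k] Nd].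
  apply/desc_runP; split => //; [by rewrite inE | by move=> i; lia |].
  move=> i lt_1i; have [lt_i|le_i] := ltnP (k.-1 + 1) i; first exact: run_k.
  apply/negP => iw; have [_ le_in _] := descsetP _ _ _ iw.
  have lt_n : (k.-1 + 1 < n)%N by lia.
  by have /negP := Nd lt_n; apply; apply: des_lt_run iw _ _; lia.
suff -> : descperms k fset0 n
    = desc_run k n [set: 'S_1]%SET 0 :\: desc_exact k n [set: 'S_1]%SET k.-1.
  rewrite cardsD (finset.setIidPr sub) subnK //; exact: subset_leq_card.
apply/finset.setP => w; rewrite inE finset.in_setD.
apply/eqP/andP => [E|[NC /desc_runP[_ _ _ run_w]]].
  have run_w i : i \notin descset k w by rewrite E in_fset0.
  split; last by apply/desc_runP; split => //; rewrite ?inE //; lia.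
  apply/negP => /desc_exactP[/desc_runP[le_n _ des_k _] _].
  have /negP := run_w 1%N; apply; apply/descsetP.
  by split=> [||j h1 h2]; [lia | lia | apply: des_k; lia].
apply/fsetP => i; rewrite in_fset0; apply/negP => iw.
have [i_gt0 le_n des_i] := descsetP _ _ _ iw.
have [lt_i|le_i] := ltnP 1 i; first by have := run_w i; rewrite add0n iw => /(_ lt_i).
have Ei : i = 1%N by lia.
case/negP: NC; apply/desc_exactP; split.
  apply/desc_runP; split; [lia | by rewrite inE | |].
    by move=> j h1 h2; apply: des_i; lia.
  by move=> j h; apply: run_w; lia.
move=> lt_n; apply/negP => des_last.
have /negP := run_w 2 (ltnSn _); apply; apply/descsetP.
split=> [||j h1 h2]; [lia | lia |].
by have [->//|ne] := eqVneq j (k.-1 + 1)%N; apply: des_i; lia.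
Qed.

Lemma descset_append_max k n (s : 'S_n) : (1 < k)%N -> (0 < n)%N ->
  descset k (append s ord_max) = descset k s.
Proof.
move=> k_gt1 n_gt0; rewrite (@descset_glue k n) ?seg_append //.
  by rewrite des_append_last //= -ltnNge lastrank_lt.
by apply: avoids_short; lia.
Qed.

(** The last two letters form a descent of length two preceded by an ascent, and
    a run needs at least three letters. *)
Lemma descset_append_max_min k n (s : 'S_n) : (2 < k)%N -> (0 < n)%N ->
  descset k (append (append s ord_max) ord0) = descset k s.
Proof.
move=> k_ge3 n_gt0; have le_n2 : (n <= n.+2)%N by lia.
rewrite (descset_glue le_n2) => [|_|].
- have := @seg_seg n 0 n.+1 0 _ (append (append s ord_max) ord0) (leqnSn n) (leqnSn _).
  by rewrite !seg_append => <-.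
- by rewrite des_append ?ltnSn ?n_gt0 // des_append_last //= -ltnNge lastrank_lt.
- by apply: avoids_short; lia.
Qed.

(** The prefixes that will make the main term positive: long, and ending with
    their smallest letter. *)
Lemma ex_descset_last_min k (I : {fset nat}) t (s : 'S_t) : (2 < k)%N ->
  (0 < t)%N -> descset k s = I -> forall q,
  exists v : 'S_(q.+2 + t), descset k v = I /\ lastrank v = 0%N.
Proof.
move=> k_ge3 t_gt0 sI q.
have [u uI] : exists u : 'S_(q + t), descset k u = I.
  elim: q => [|q [u uI]]; first by exists s.
  have qt_gt0 : (0 < q + t)%N by lia.
  by exists (append u ord_max); rewrite -uI descset_append_max // ltnW.
have qt_gt0 : (0 < q + t)%N by lia.
exists (append (append u ord_max) ord0); split; last exact: lastrank_append.
by rewrite -uI; exact: descset_append_max_min.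
Qed.

(** * Exact formulas *)

(** The signs 1, -1, 0, ..., 0, 1, -1, 0, ... of period [k]. *)
Definition alt (R : pzRingType) (k j : nat) : R :=
  if j is j'.+1 then (k %| j)%:R - (k %| j')%:R else 1.

(** Iterating C l = A l - A (l + 1) + C (l + k) until the terms vanish. *)
Lemma alt_inversion (R : comPzRingType) (k m : nat) (A C : nat -> R) (l : nat) :
  (0 < k)%N ->
  (forall j, A j - A j.+1 = C j - C (j + k)%N) ->
  (forall j, (m < j)%N -> A j = 0) -> (forall j, (m < j)%N -> C j = 0) ->
  C l = \sum_(j < m.+1) alt R k j * A (l + j)%N.
Proof.
move=> k_gt0 AC A0 C0.
(* Only the terms with [j < k] survive, and there [k] divides [j = 0] alone. *)
have telC M : \sum_(j < M + k) (k %| j)%:R * C (l + j)%N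
    - \sum_(j < M) (k %| j)%:R * C (l + j + k)%N = C l.
  elim: M => [|M IHM]; last first.
    rewrite addSn !big_ord_recr /= -[RHS]IHM addnA dvdn_addl ?dvdnn //.
    by ring.
  rewrite add0n big_ord0 subr0 (bigD1 (Ordinal k_gt0)) //= dvdn0 mul1r addn0.
  rewrite big1 ?addr0 // => j; rewrite -val_eqE /= -lt0n => j_gt0.
  by rewrite gtnNdvd ?mul0r.
have telA M : \sum_(j < M.+1) alt R k j * A (l + j)%N
    = \sum_(j < M.+1) (k %| j)%:R * (A (l + j)%N - A (l + j).+1)
      + (k %| M)%:R * A (l + M).+1.
  elim: M => [|M IHM].
    by rewrite !big_ord_recl !big_ord0 /= dvdn0 !addn0 !mul1r; ring.
  rewrite big_ord_recr IHM [in RHS]big_ord_recr /= !addnS.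
  by ring.
rewrite telA (A0 (l + m).+1) ?ltnS ?leq_addl // mulr0 addr0.
rewrite -(telC m.+1) big_split_ord /=.
rewrite [X in _ + X - _]big1 ?addr0 => [|j _]; last by rewrite C0 ?mulr0 //; lia.
by rewrite -sumrB; apply: eq_bigr => j _; rewrite AC mulrBr.
Qed.

Lemma sum_alt_period (R : pzRingType) k (g : nat -> R) : (1 < k)%N ->
  \sum_(i < k) alt R k i * g i = g 0%N - g 1%N.
Proof.
case: k => [|[|k]] // _; rewrite !big_ord_recl big1 => [|i _].
  by rewrite /= mul1r sub0r mulN1r addr0.
have lt_i := ltn_ord i; rewrite /alt /= /bump /= !gtnNdvd ?subrr ?mul0r // ltnS leqW //.
Qed.

Lemma alt_shift (R : pzRingType) k j : (1 < k)%N -> alt R k (k + j) = alt R k j.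
Proof.
case: j => [|j] k_gt1; rewrite ?addn0 ?addnS /=; last first.
  by rewrite -addnS !dvdn_addr ?dvdnn.
by case: k k_gt1 => // k k_gt1; rewrite /= dvdnn gtnNdvd ?subr0.
Qed.

Section ExactFormula.
Variables (R : realType) (k : nat).

Definition avoid_prob (n : nat) : R := (f k n)%:R / n`!%:R.

(** The proportion, among all orderings of [j + t] letters, of those that continue
    a pattern in [S] by [j] descents. *)
Definition ext_weight t (S : {set 'S_t}) (j : nat) : R :=
  (\sum_(v in S) 'C(lastrank v + j, j))%N%:R / (j + t)`!%:R.

Lemma fact_neq0 n : n`!%:R != 0 :> R.
Proof. by rewrite pnatr_eq0 -lt0n fact_gt0. Qed.

Lemma f_avoid_prob n : (f k n)%:R = n`!%:R * avoid_prob n.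
Proof. by rewrite /avoid_prob mulrC divfK ?fact_neq0. Qed.

Lemma desc_run_weight t n (S : {set 'S_t}) j : (0 < t)%N -> (j + t <= n)%N ->
  #|desc_run k n S j|%:R
  = n`!%:R * (ext_weight S j * avoid_prob (n - (j + t))).
Proof.
move=> t_gt0 le_n; rewrite card_desc_run // !natrM f_avoid_prob.
rewrite -(bin_fact le_n) !natrM /ext_weight.
by field; rewrite fact_neq0.
Qed.

Lemma desc_exact_weight t m (S : {set 'S_t}) l : (0 < t)%N -> (1 < k)%N ->
  #|desc_exact k (m + t) S l|%:R
  = (m + t)`!%:R * \sum_(j < m.+1 | (l + j <= m)%N)
      alt R k j * ext_weight S (l + j) * avoid_prob (m - (l + j)).
Proof.
move=> t_gt0 k_gt1.
have run0 j : (m < j)%N -> #|desc_run k (m + t) S j|%:R = 0 :> R.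
  by move=> lt_j; rewrite desc_run_gt ?cards0 // ltn_add2r.
have exact0 j : (m < j)%N -> #|desc_exact k (m + t) S j|%:R = 0 :> R.
  by move=> lt_j; rewrite desc_exact_gt ?cards0 // ltn_add2r.
have step j : #|desc_run k (m + t) S j|%:R - #|desc_run k (m + t) S j.+1|%:R
    = #|desc_exact k (m + t) S j|%:R - #|desc_exact k (m + t) S (j + k)|%:R :> R.
  apply/eqP; rewrite subr_eq addrAC eq_sym subr_eq eq_sym -!natrD.
  by rewrite card_desc_run_step // addnC.
rewrite (alt_inversion l (ltnW k_gt1) step run0 exact0) mulr_sumr.
rewrite [RHS]big_mkcond; apply: eq_bigr => j _.
case: leqP => [le_m|/run0->]; last by rewrite mulr0.
rewrite desc_run_weight ?leq_add2r // subnDr.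
by rewrite mulrCA !mulrA.
Qed.

Lemma d_weight (I : {fset nat}) m : (1 < k)%N -> I != fset0 ->
  (forall i, i \in I -> (0 < i)%N) ->
  let t := (\max_(i <- I) i + k - 1)%N in (0 < t)%N ->
  (d k I (m + t))%:R = (m + t)`!%:R *
    \sum_(j < m.+1) alt R k j * ext_weight (descperms k I t) j * avoid_prob (m - j).
Proof.
move=> k_gt1 I_neq0 I_gt0 t t_gt0.
rewrite /d (descperms_exact k_gt1 I_neq0 I_gt0 (leq_addl _ _)).
rewrite desc_exact_weight //; congr (_ * _).
by apply: eq_bigl => j; rewrite add0n -ltnS ltn_ord.
Qed.

(** The sieve with a prefix of one letter; in generating functions, the product of
    sum_n f_k(n) z^n / n! with sum_j alt_j z^j / j! is [1]. *)
Lemma avoid_prob_recurrence m : (1 < k)%N ->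
  \sum_(j < m.+2) alt R k j / j`!%:R * avoid_prob (m.+1 - j) = 0.
Proof.
move=> k_gt1.
(* [q] is extended by zero so that shifting the index by [k] is harmless. *)
pose q j := if (j <= m.+1)%N then avoid_prob (m.+1 - j) / j`!%:R else 0.
have w1 j : ext_weight [set: 'S_1]%SET j = j.+1`!%:R^-1.
  rewrite /ext_weight addn1 (eq_bigr (fun=> 1%N)).
    by rewrite sum1_card cardsT card_Sn mul1r.
  move=> v _; have := lastrank_lt v (ltnSn 0); rewrite ltnS leqn0 => /eqP->.
  by rewrite add0n binn.
have run : #|desc_run k (m + 1) [set: 'S_1]%SET 0|%:R = (m + 1)`!%:R * q 1%N.
  rewrite desc_run_weight ?leq_addl // w1 add0n addnK /q /= subn1 /=; congr (_ * _).
  by rewrite mulrC.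
have exact : #|desc_exact k (m + 1) [set: 'S_1]%SET k.-1|%:R
    = (m + 1)`!%:R * \sum_(j < m.+1) alt R k j * q (k + j)%N.
  rewrite desc_exact_weight //; congr (_ * _); rewrite big_mkcond.
  apply: eq_bigr => j _; rewrite /q.
  have -> : (k + j)%N = (k.-1 + j).+1 by lia.
  rewrite ltnS subSS; case: leqP => _; last by rewrite mulr0.
  by rewrite w1 -mulrA [X in _ * X]mulrC.
have sum_q : avoid_prob m.+1 + \sum_(j < m.+1) alt R k j * q (k + j)%N = q 1%N.
  have := card_avoids k_gt1 (ltn0Sn m); rewrite -[m.+1]addn1.
  move/(congr1 (fun x : nat => x%:R : R)); rewrite natrD run exact f_avoid_prob.
  move=> E; apply: (mulfI (fact_neq0 (m + 1))); rewrite -E mulrDr.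
  by rewrite addn1.
have -> : \sum_(j < m.+2) alt R k j / j`!%:R * avoid_prob (m.+1 - j)
   = \sum_(j < k + m.+1) alt R k j * q j.
  rewrite (big_ord_widen _ (fun j => alt R k j / j`!%:R * avoid_prob (m.+1 - j))
    (_ : m.+2 <= k + m.+1)%N); last lia.
  rewrite big_mkcond; apply: eq_bigr => j _; rewrite ltnS /q.
  by case: ifP => _; rewrite ?mulr0 // -mulrA [X in _ * X]mulrC.
rewrite big_split_ord /=.
have q0 : q 0%N = avoid_prob m.+1 by rewrite /q /= subn0 divr1.
rewrite sum_alt_period //.
rewrite (eq_bigr (fun j : 'I_m.+1 => alt R k j * q (k + j)%N)); last first.
  by move=> j _; rewrite alt_shift.
by rewrite -sum_q q0; ring.
Qed.

(** The inequality C 0 >= A 0 - A 1 of the sieve.  A prefix ending with its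
    smallest letter makes the subtracted term smaller by a factor of order 1 / T. *)
Lemma d_weight_ge (I : {fset nat}) T m (S : {set 'S_T}) : (1 < k)%N ->
  (0 < T)%N -> S \subset descperms k I T ->
  (forall v, v \in S -> lastrank v = 0%N) ->
  (m.+1 + T)`!%:R * (#|S|%:R / T`!%:R
     * (avoid_prob m.+1 - avoid_prob m / T.+1%:R)) <= (d k I (m.+1 + T))%:R.
Proof.
move=> k_gt1 T_gt0 SI S0.
have weight j : ext_weight S j = #|S|%:R / (j + T)`!%:R.
  rewrite /ext_weight (eq_bigr (fun=> 1%N)) ?sum1_card // => v /S0 ->.
  by rewrite add0n binn.
apply: (@le_trans _ _ #|desc_exact k (m.+1 + T) S 0|%:R); last first.
  by rewrite ler_nat subset_leq_card // desc_exact0_sub.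
have := card_desc_exact0_ge (m.+1 + T) S k_gt1; rewrite -(ler_nat R) natrD.
rewrite -lerBlDr; apply: le_trans.
rewrite !desc_run_weight //; [| lia | lia].
rewrite !weight add0n add1n addnK addSnnS addnK factS natrM -mulrBr.
rewrite ler_pM2l ?ltr0n ?fact_gt0 //.
have h1 := fact_neq0 T; have h2 : T.+1%:R != 0 :> R by rewrite pnatr_eq0.
rewrite le_eqVlt; apply/orP; left; apply/eqP; field.
by rewrite h1 nat1r h2.
Qed.

End ExactFormula.

(** * Convolutions with geometric asymptotics *)

Lemma exp_partial_sum_le (R : realType) (x : R) m : 0 <= x ->
  \sum_(j < m) x ^+ j / j`!%:R <= expR x.
Proof.
move=> x_ge0.
have nd : nondecreasing_seq (series (exp_coeff x)).
  by apply: nondecreasing_series => n _ _; exact: exp_coeff_ge0.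
rewrite /expR; apply: le_trans _ (nondecreasing_cvgn_le nd (is_cvg_series_exp_coeff x) m).
by rewrite /series /= big_mkord.
Qed.

Lemma is_cvg_pseries_fact (R : realType) (c : nat -> R) B K :
  (forall i, `|c i| <= B / i`!%:R) -> cvgn (pseries c K).
Proof.
move=> c_le; apply: normed_cvg.
have B0 : 0 <= B.
  by have := le_trans (normr_ge0 _) (c_le 0%N); rewrite fact0 divr1.
apply: (series_le_cvg (v_ := fun j => B * (`|K| ^+ j / j`!%:R))) => [j|j|j|].
- exact: normr_ge0.
- by rewrite mulr_ge0 ?divr_ge0 ?exprn_ge0.
- by rewrite /= normrM normrX [leRHS]mulrCA [leRHS]mulrC ler_wpM2r ?exprn_ge0.
- apply: is_cvg_seriesZ; exact: is_cvg_series_exp_coeff.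
Qed.

Lemma is_cvg_geometric_fact (R : realType) (b : nat -> R) B r :
  (forall j, `|b j| <= B / j`!%:R) -> cvgn (series (fun j => b j / r ^+ j)).
Proof.
move=> b_le; rewrite (_ : (fun j => _) = fun j => b j * r^-1 ^+ j).
  exact: (@is_cvg_pseries_fact _ _ _ r^-1 b_le).
by apply/funext => j; rewrite exprVn.
Qed.

Section Transfer.
Variables (R : realType) (c r gam E B : R) (p b : nat -> R).
Hypotheses (c_ge0 : 0 <= c) (r_gt0 : 0 < r) (gam_gt0 : 0 < gam) (gam_lt1 : gam < 1).
Hypothesis p_asymp : forall n, `|p n - c * r ^+ n| <= E * (r * gam) ^+ n.
Hypothesis b_bound : forall j, `|b j| <= B / j`!%:R.

Let x := (r * gam)^-1.

Lemma x_ge0 : 0 <= x.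
Proof. by rewrite invr_ge0 mulr_ge0 ?ltW. Qed.

Lemma bound_ge0 : 0 <= B.
Proof. by have := le_trans (normr_ge0 _) (b_bound 0); rewrite fact0 divr1. Qed.

Lemma error_ge0 : 0 <= E.
Proof. by have := le_trans (normr_ge0 _) (p_asymp 0); rewrite expr0 mulr1. Qed.

(** Writing b_j / r^j = gam^j (b_j / (r gam)^j), the factorials absorb the second
    factor, and gam^j <= gam^m is gained for free. *)
Lemma geometric_term_le m j : (m <= j)%N ->
  `|b j / r ^+ j| <= gam ^+ m * B * (x ^+ j / j`!%:R).
Proof.
move=> le_mj; rewrite normrM normfV (ger0_norm (exprn_ge0 j (ltW r_gt0))).
apply: (@le_trans _ _ (gam ^+ j * B * (x ^+ j / j`!%:R))); last first.
  rewrite ler_wpM2r ?divr_ge0 ?exprn_ge0 ?x_ge0 //.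
  by rewrite ler_wpM2r ?bound_ge0 // ler_wiXn2l // ltW.
rewrite /x exprVn exprMn.
have -> : gam ^+ j * B * ((r ^+ j * gam ^+ j)^-1 / j`!%:R) = B / j`!%:R / r ^+ j.
  have := expf_neq0 j (lt0r_neq0 gam_gt0); have := expf_neq0 j (lt0r_neq0 r_gt0).
  by move=> h1 h2; field; rewrite h1 h2 fact_neq0.
by rewrite ler_wpM2r ?invr_ge0 ?exprn_ge0 ?b_bound // ltW.
Qed.

Lemma geometric_tail_le m n : (m <= n)%N ->
  `|\sum_(m <= j < n) b j / r ^+ j| <= gam ^+ m * B * expR x.
Proof.
move=> le_mn; apply: le_trans (ler_norm_sum _ _ _) _.
apply: (@le_trans _ _ (\sum_(m <= j < n) gam ^+ m * B * (x ^+ j / j`!%:R))).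
  by apply: ler_sum_nat => j /andP[h _]; exact: geometric_term_le.
rewrite -mulr_sumr ler_wpM2l ?mulr_ge0 ?exprn_ge0 ?bound_ge0 ?(ltW gam_gt0) //.
apply: le_trans _ (exp_partial_sum_le n x_ge0).
rewrite -[leRHS](big_mkord xpredT (fun j => x ^+ j / j`!%:R)).
rewrite [leRHS](big_cat_nat (leq0n m) le_mn) //= lerDr sumr_ge0 // => j _.
by rewrite divr_ge0 ?exprn_ge0 ?x_ge0.
Qed.

Lemma partial_sum_limn_le m :
  `|\sum_(j < m) b j / r ^+ j - limn (series (fun j => b j / r ^+ j))|
    <= gam ^+ m * B * expR x.
Proof.
set s := series _; rewrite distrC.
have s_cvg : s @ \oo --> limn s := @is_cvg_geometric_fact _ _ _ r b_bound.
have norm_cvg : (fun n => `|s n - \sum_(j < m) b j / r ^+ j|) @ \oo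
    --> `|limn s - \sum_(j < m) b j / r ^+ j|.
  by apply: cvg_norm; apply: cvgB => //; exact: cvg_cst.
apply: (cvgr_to_le norm_cvg); near=> n.
have le_mn : (m <= n)%N by near: n; exact: nbhs_infty_ge.
rewrite /s /series /= (big_cat_nat (leq0n m) le_mn) //= big_mkord addrAC subrr add0r.
exact: geometric_tail_le.
Unshelve. all: by end_near. Qed.

(** Convolution with coefficients decaying like 1 / j! preserves an asymptotic
    c r^m (1 + O(gam^m)) and multiplies [c] by the value of the power series at
    1 / r.  Both the error made on each [p (m - j)] and the truncation of the
    series are O((r gam)^m). *)
Lemma geometric_convolution m :
  `|\sum_(j < m.+1) b j * p (m - j)%N
    - c * r ^+ m * limn (series (fun j => b j / r ^+ j))|
    <= B * (E + c) * expR x * (r * gam) ^+ m.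
Proof.
set Z := limn _.
have rm_ge0 : 0 <= r ^+ m by rewrite exprn_ge0 // ltW.
have rgam_ge0 : 0 <= (r * gam) ^+ m by rewrite exprn_ge0 // mulr_ge0 // ltW.
have -> : \sum_(j < m.+1) b j * p (m - j)%N - c * r ^+ m * Z
  = \sum_(j < m.+1) b j * (p (m - j)%N - c * r ^+ (m - j))
    + c * r ^+ m * (\sum_(j < m.+1) b j / r ^+ j - Z).
  rewrite mulrBr mulr_sumr addrA; congr (_ - _); rewrite -big_split /=.
  apply: eq_bigr => j _; rewrite mulrBr.
  have -> : r ^+ m = r ^+ (m - j) * r ^+ j by rewrite -exprD subnK // -ltnS.
  have := expf_neq0 j (lt0r_neq0 r_gt0) => h.
  by field.
apply: le_trans (ler_normD _ _) _.
have -> : B * (E + c) * expR x * (r * gam) ^+ m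
  = B * E * (r * gam) ^+ m * expR x + c * r ^+ m * (gam ^+ m * B * expR x).
  by rewrite exprMn; ring.
apply: lerD; last first.
  rewrite normrM ger0_norm ?mulr_ge0 // ler_wpM2l ?mulr_ge0 //.
  apply: le_trans (partial_sum_limn_le _) _.
  rewrite -!mulrA ler_wpM2r ?mulr_ge0 ?bound_ge0 ?expR_ge0 //.
  by rewrite ler_wiXn2l // ltW.
apply: (@le_trans _ _ (B * E * (r * gam) ^+ m * \sum_(j < m.+1) x ^+ j / j`!%:R)).
  rewrite mulr_sumr; apply: le_trans (ler_norm_sum _ _ _) _.
  apply: ler_sum => j _; rewrite normrM.
  apply: (@le_trans _ _ ((B / j`!%:R) * (E * (r * gam) ^+ (m - j)))).
    by apply: ler_pM.
  have -> : (r * gam) ^+ m = (r * gam) ^+ (m - j) * (r * gam) ^+ j.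
    by rewrite -exprD subnK // -ltnS.
  have h : (r * gam) ^+ j != 0 by rewrite expf_neq0 // mulf_neq0 ?lt0r_neq0.
  rewrite /x exprVn le_eqVlt; apply/orP; left; apply/eqP; field.
  by rewrite fact_neq0 h.
by rewrite ler_wpM2l ?mulr_ge0 ?bound_ge0 ?error_ge0 // exp_partial_sum_le ?x_ge0.
Qed.

End Transfer.

(** * Integrals of polynomials *)

Section PolyIntegral.
Variable R : realType.
Local Notation mu := (@lebesgue_measure R).
Implicit Types P Q : {poly R}.

Lemma continuous_integrable01 (g : R -> R) : continuous g ->
  mu.-integrable `[0, 1] (EFin \o g).
Proof.
move=> g_cont; apply: continuous_compact_integrable; first exact: segment_compact.
exact: continuous_subspaceT.
Qed.

Lemma Rintegral_deriv Q (x : R) : 0 <= x ->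
  \int[mu]_(y in `[0, x]) (Q^`()).[y] = Q.[x] - Q.[0].
Proof.
rewrite le_eqVlt => /predU1P[<-|x_gt0].
  by rewrite set_itv1 Rintegral_set1 subrr.
rewrite /Rintegral (@continuous_FTC2 _ (horner Q^`()) (horner Q)) ?fineB //.
- exact/continuous_subspaceT/continuous_horner.
- split=> [y _||]; first exact: derivable_horner.
  + exact/cvg_at_right_filter/continuous_horner.
  + exact/cvg_at_left_filter/continuous_horner.
- by move=> y _; rewrite -derivE.
Qed.

(** The antiderivative vanishing at 0; the constant coefficient is [0 / 0 = 0]. *)
Definition prim P : {poly R} := \poly_(i < (size P).+1) (P`_i.-1 / i%:R).

Lemma coef_prim P i : (prim P)`_i = P`_i.-1 / i%:R.
Proof.
rewrite coef_poly; case: ltnP => //; case: i => // i; rewrite ltnS => h.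
by rewrite nth_default ?mul0r.
Qed.

Lemma prim_linear : linear prim.
Proof.
move=> a P Q; apply/polyP => i.
by rewrite !(coefD, coefZ, coef_prim) mulrDl mulrA.
Qed.

HB.instance Definition _ := GRing.isLinear.Build R {poly R} {poly R} _ prim prim_linear.

Lemma deriv_prim P : (prim P)^`() = P.
Proof.
apply/polyP => i; rewrite coef_deriv coef_prim /= -[LHS]mulr_natr divfK ?pnatr_eq0 //.
Qed.

Lemma prim0 P : (prim P).[0] = 0.
Proof. by rewrite horner_coef0 coef_prim invr0 mulr0. Qed.

(** The integral over [0, 1], as a linear form on polynomials. *)
Definition int01 P : R := (prim P).[1].

Lemma int01_linear : scalar int01.
Proof. by move=> a P Q; rewrite /int01 linearP hornerD hornerZ. Qed.

HB.instance Definition _ := GRing.isLinear.Build R {poly R} R _ int01 int01_linear.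

Lemma Rintegral_prim P (x : R) : 0 <= x ->
  \int[mu]_(y in `[0, x]) P.[y] = (prim P).[x].
Proof.
by move=> x_ge0; rewrite -{1}(deriv_prim P) Rintegral_deriv // prim0 subr0.
Qed.

Lemma int01E P : \int[mu]_(y in `[0, 1]) P.[y] = int01 P.
Proof. by rewrite Rintegral_prim. Qed.

Lemma int01_beta a b :
  int01 ('X^a * (1 - 'X) ^+ b) = (a`! * b`!)%:R / (a + b).+1`!%:R.
Proof.
rewrite -beta_fun_fact /beta_fun -Rintegral_mkcond -int01E.
by apply: eq_Rintegral => y _; rewrite !hornerE.
Qed.

Lemma int01_by_parts i P :
  int01 ('X^i * prim P) = (int01 P - int01 ('X^(i.+1) * P)) / i.+1%:R.
Proof.
have := Rintegral_deriv ('X^(i.+1) * prim P) ler01.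
rewrite int01E derivM deriv_prim derivXn /= mulrnAl linearD /= linearMn /=.
rewrite !hornerE /= prim0 mulr0 subr0 expr1n mul1r -[(prim P).[1]]/(int01 P).
by move=> <-; rewrite addrK -[_ *+ _]mulr_natr mulfK ?pnatr_eq0 //.
Qed.

Definition poly_bound P : R := \sum_(i < size P) `|P`_i|.

Lemma horner_bound P (x : R) : 0 <= x <= 1 -> `|P.[x]| <= poly_bound P.
Proof.
move=> /andP[x_ge0 x_le1]; rewrite horner_coef.
apply: le_trans (ler_norm_sum _ _ _) _; apply: ler_sum => i _.
by rewrite normrM ler_piMr // normrX exprn_ile1 ?ger0_norm.
Qed.

Lemma Rintegral_diff_le (g h : R -> R) (e : R) : continuous g -> continuous h ->
  (forall x, 0 <= x <= 1 -> `|g x - h x| <= e) ->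
  `|\int[mu]_(x in `[0, 1]) g x - \int[mu]_(x in `[0, 1]) h x| <= e.
Proof.
move=> g_cont h_cont gh.
have gh_cont : continuous (fun x => g x - h x).
  by move=> x; apply: cvgB; [exact: g_cont | exact: h_cont].
rewrite -RintegralB //; try exact: continuous_integrable01.
apply: le_trans (le_normr_Rintegral _ _) _ => //; first exact: continuous_integrable01.
apply: (@le_trans _ _ (\int[mu]_(x in `[0, 1]) e)).
  apply: le_Rintegral => //.
  - apply: continuous_integrable01 => x.
    by apply: cvg_norm; exact: gh_cont.
  - by apply: continuous_integrable01 => x; exact: cvg_cst.
rewrite Rintegral_cst //= lebesgue_measure_itv /=.
by rewrite lte_fin ltr01 /= oppr0 addr0 mulr1.
Qed.

End PolyIntegral.

(** * The double integral as a series *)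

Section Phi.
Variable R : realType.
Local Notation mu := (@lebesgue_measure R).

Lemma norm_alt_le1 k j : `|alt R k j| <= 1.
Proof.
case: j => [|j]; rewrite /= ?normr1 //.
by do 2!case: (_ %| _)%N; rewrite ?subrr ?subr0 ?sub0r ?normrN ?normr0 ?normr1 ?ler01.
Qed.

Lemma pseries_diffs_fact (c : nat -> R) B :
  (forall i, `|c i| <= B / i`!%:R) ->
  forall i, `|pseries_diffs c i| <= B / i`!%:R.
Proof.
move=> c_le i; rewrite /pseries_diffs normrM normr_nat.
apply: le_trans (ler_wpM2l (ler0n _ _) (c_le i.+1)) _.
rewrite factS natrM; have h := fact_neq0 R i.
have h' : i.+1%:R != 0 :> R by rewrite pnatr_eq0.
rewrite le_eqVlt; apply/orP; left; apply/eqP; field.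
by rewrite h nat1r h'.
Qed.

(** Coefficients bounded by B / i! are stable under formal differentiation, so the
    sum is differentiable everywhere. *)
Lemma pseries_fact_continuous (c : nat -> R) B :
  (forall i, `|c i| <= B / i`!%:R) -> continuous (fun x => limn (pseries c x)).
Proof.
move=> c_le x.
have lt_x : `|x| < `| (`|x| + 1) |.
  by rewrite [ltRHS]ger0_norm ?addr_ge0 // ltrDl.
have c1 := pseries_diffs_fact c_le; have c2 := pseries_diffs_fact c1.
have := pseries_snd_diffs (@is_cvg_pseries_fact _ _ _ _ c_le)
  (@is_cvg_pseries_fact _ _ _ _ c1) (@is_cvg_pseries_fact _ _ _ _ c2) lt_x.
move=> /@ex_derive /derivable1_diffP; exact: differentiable_continuous.
Qed.

Definition phi_coef k m : R := ((k %| m)%:R - (k %| m.+1)%:R) / m`!%:R.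

Lemma phi_coefE k m : phi_coef k m = - alt R k m.+1 / m`!%:R.
Proof. by rewrite /= opprB. Qed.

Lemma phi_coef_le k m : `|phi_coef k m| <= 1 / m`!%:R.
Proof.
rewrite phi_coefE normrM normrN normfV normr_nat ler_wpM2r ?invr_ge0 //.
exact: norm_alt_le1.
Qed.

Lemma phi_continuous k (r : R) : continuous (phi k r).
Proof.
move=> x; apply: (@continuousM R R (cst r^-1)); first exact: cvg_cst.
pose g (y : R) : R := limn (pseries (phi_coef k) y).
have g_cont : continuous g := pseries_fact_continuous (@phi_coef_le k).
apply: (@continuous_comp R R R ( *%R^~ r^-1) g x) (g_cont _).
by apply: mulrr_continuous.
Qed.

Definition phi_poly k (r : R) M : {poly R} :=
  \sum_(i < M) (r^-1 * (phi_coef k i / r ^+ i)) *: 'X^i.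

(** The truncation error of the power series at 1 / r whose coefficients are
    those of phi multiplied by [x ^+ i]. *)
Lemma phi_poly_approx k (r : R) M x : 0 < r -> 0 <= x <= 1 ->
  `|phi k r x - (phi_poly k r M).[x]|
    <= r^-1 * (2^-1 ^+ M * expR ((r * 2^-1)^-1)).
Proof.
move=> r_gt0 /andP[x_ge0 x_le1].
have -> : (phi_poly k r M).[x]
    = r^-1 * \sum_(i < M) phi_coef k i * x ^+ i / r ^+ i.
  rewrite /phi_poly horner_sum mulr_sumr; apply: eq_bigr => i _.
  by rewrite hornerZ hornerXn; move: (phi_coef k i) => a; ring.
have -> : phi k r x = r^-1 * limn (series (fun i => phi_coef k i * x ^+ i / r ^+ i)).
  have -> : (fun i => phi_coef k i * x ^+ i / r ^+ i)
      = (fun i => phi_coef k i * (x / r) ^+ i).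
    by apply/funext => i; rewrite expr_div_n mulrA.
  by [].
have ri_ge0 : 0 <= r^-1 by rewrite invr_ge0 ltW.
rewrite -mulrBr normrM (ger0_norm ri_ge0) ler_wpM2l // distrC -[_ ^+ M]mulr1.
apply: partial_sum_limn_le => //; [by rewrite invf_lt1 ?ltr1n|].
move=> j; rewrite normrM; apply: le_trans (phi_coef_le k j).
by rewrite ler_piMr // normrX exprn_ile1 // ger0_norm.
Qed.

Section Value.
Variables (k t : nat) (S : {set 'S_t}).
Hypothesis t_gt0 : (0 < t)%N.

Definition Phi_poly s : {poly R} :=
  (t`!%:R / ((s.-1)`!%:R * (t - s)`!%:R)) *: ('X^(s.-1) * (1 - 'X) ^+ (t - s)).

Definition Phi_sum : {poly R} := \sum_(tau in S) Phi_poly (letter tau t).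

Lemma Phi_sumE y : Phi_sum.[y] = \sum_(tau in S) Phi t (letter tau t) y.
Proof.
rewrite horner_sum; apply: eq_bigr => tau _.
by rewrite /Phi_poly /Phi !hornerE.
Qed.

Lemma letter_lastrank (tau : 'S_t) : letter tau t = (lastrank tau).+1.
Proof.
rewrite /lastrank; case: t t_gt0 tau => // t' _ tau.
by rewrite (letterE tau (ltnSn t')).
Qed.

(** Each summand is a Beta integral; up to factorials, the binomial coefficient
    in [ext_weight] is the a-th moment of the order statistic of rank tau(t). *)
Lemma int01_Phi_sum a :
  int01 ('X^a * Phi_sum) = t`!%:R * a`!%:R * ext_weight R S a.
Proof.
rewrite /Phi_sum mulr_sumr linear_sum /= /ext_weight natr_sum mulr_suml mulr_sumr.
apply: eq_bigr => tau _; rewrite letter_lastrank /Phi_poly /=.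
rewrite -scalerAr linearZ /= mulrA -exprD int01_beta.
have lt_t := lastrank_lt tau t_gt0; move: (lastrank tau) lt_t => s lt_s.
have -> : ((a + s) + (t - s.+1)).+1 = (a + t)%N by lia.
have := bin_fact (leq_addl s a); rewrite addnK => binE.
rewrite addnC -binE !natrM.
have h1 := fact_neq0 R s; have h2 := fact_neq0 R (t - s.+1).
have h3 := fact_neq0 R (a + t).
by field; rewrite h1 h2 h3.
Qed.

(** Among orderings of [j + t] letters, those with a given pattern on the first [t]
    and descending on the last [j] are at most a fraction 1 / j! of the whole. *)
Lemma alt_weight_le j : `|alt R k j * ext_weight R S j| <= #|S|%:R / j`!%:R.
Proof.
rewrite normrM -[leRHS]mul1r; apply: ler_pM => //; first exact: norm_alt_le1.
have w_ge0 : 0 <= ext_weight R S j by rewrite divr_ge0.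
rewrite (ger0_norm w_ge0) /ext_weight natr_sum mulr_suml.
have -> : #|S|%:R / j`!%:R = \sum_(v in S) j`!%:R^-1 :> R.
  by rewrite sumr_const mulr_natl.
apply: ler_sum => v _.
have lt_t := lastrank_lt v t_gt0; move: (lastrank v) lt_t => s lt_s.
have h1 := fact_neq0 R j; have h2 : 0 < (j + t)`!%:R :> R by rewrite ltr0n fact_gt0.
rewrite ler_pdivrMr // -(ler_pM2l (_ : 0 < j`!%:R)) ?ltr0n ?fact_gt0 //.
rewrite mulrA mulfV // mul1r -natrM ler_nat mulnC.
have /bin_fact := leq_addl s j; rewrite addnK => bf.
apply: (@leq_trans (s + j)`!); last by rewrite leq_fact //; lia.
rewrite -bf mulnA leq_pmulr ?fact_gt0 //.
Qed.

Variable r : R.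
Hypothesis r_gt0 : 0 < r.

Let partial_alt n : R := \sum_(j < n) alt R k j / j`!%:R / r ^+ j.
Let partial_weight n : R := \sum_(j < n) alt R k j * ext_weight R S j / r ^+ j.

(** Integration by parts turns the coefficient of x^i in phi into the difference of
    the terms of index i + 1 of two series: the moment of order i + 1 of the
    inner integrand, and its total mass. *)
Lemma int01_phi_poly M :
  int01 (phi_poly k r M * prim Phi_sum)
  = t`!%:R * (partial_weight M.+1 - ext_weight R S 0 * partial_alt M.+1).
Proof.
rewrite /partial_weight /partial_alt !big_ord_recl /= !expr0 fact0 !divr1 mul1r.
rewrite [_ * (1 + _)]mulrDr mulr1 opprD addrACA subrr add0r mulr_sumr -sumrB mulr_sumr.
rewrite /phi_poly mulr_suml linear_sum; apply: eq_bigr => i _ /=.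
rewrite -scalerAl linearZ /= int01_by_parts int01_Phi_sum.
have := int01_Phi_sum 0; rewrite expr0 mul1r => ->.
rewrite phi_coefE !exprS /bump /= !add1n factS natrM.
have h1 := fact_neq0 R i; have h2 : i.+1%:R != 0 :> R by rewrite pnatr_eq0.
have h3 : r ^+ i != 0 by rewrite expf_neq0 // lt0r_neq0.
have h4 := lt0r_neq0 r_gt0.
rewrite fact0; field.
by rewrite h1 h4 h3 nat1r h2.
Qed.

(** The double integral is the value at 1 / r of the series that governs d_k(I, n),
    up to a multiple of sum_j alt_j r^-j / j!, which vanishes because 1 / r is a
    pole of the generating function of f_k. *)
Lemma integral_value :
  limn (series (fun j => alt R k j / j`!%:R / r ^+ j)) = 0 ->
  \int[mu]_(x in `[0, 1]) (phi k r x *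
     \int[mu]_(y in `[0, x]) \sum_(tau in S) Phi t (letter tau t) y)
  = t`!%:R * limn (series (fun j => alt R k j * ext_weight R S j / r ^+ j)).
Proof.
set Z := limn _; set W := limn _ => Z0.
rewrite (@eq_Rintegral _ _ _ mu _ (fun x => phi k r x * (prim Phi_sum).[x])); last first.
  move=> x; rewrite inE /= in_itv /= => /andP[x_ge0 _]; congr (_ * _).
  by rewrite -Rintegral_prim //; apply: eq_Rintegral => y _; rewrite Phi_sumE.
set L := (X in X = _); set Q := prim Phi_sum in L *.
pose u M : R := int01 (phi_poly k r M * Q).
have u_L : u @ \oo --> L.
  (* phi is replaced by its Taylor polynomials, uniformly on [0, 1]. *)
  pose K : R := r^-1 * expR ((r * 2^-1)^-1) * poly_bound Q.
  have K_cvg : (fun M => 2^-1 ^+ M * K) @ \oo --> (0 : R).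
    rewrite -(mul0r K); apply: cvgM; last exact: cvg_cst.
    by apply: cvg_expr; rewrite ger0_norm ?invf_lt1 ?ltr1n.
  apply/cvgrPdist_le => e e_gt0; near=> M.
  apply: (@le_trans _ _ (2^-1 ^+ M * K)); last first.
    by near: M; exact: (cvgr_le _ K_cvg _ e_gt0).
  rewrite /L /u -int01E; apply: Rintegral_diff_le.
  - by move=> x; apply: cvgM; [exact: phi_continuous | exact: continuous_horner].
  - exact: continuous_horner.
  - move=> x x01; rewrite hornerM -mulrBl normrM.
    have -> : 2^-1 ^+ M * K = r^-1 * (2^-1 ^+ M * expR ((r * 2^-1)^-1)) * poly_bound Q.
      by rewrite /K; ring.
    by apply: ler_pM => //; [exact: phi_poly_approx | exact: horner_bound].
have u_W : u @ \oo --> t`!%:R * (W - ext_weight R S 0 * Z).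
  have -> : u = (fun M => t`!%:R * (partial_weight M.+1 - ext_weight R S 0 * partial_alt M.+1)).
    by apply/funext => M; rewrite /u int01_phi_poly.
  apply: cvgM; first exact: cvg_cst.
  apply: cvgB; last (apply: cvgM; first exact: cvg_cst).
    have -> : (fun M => partial_weight M.+1)
      = (fun M => series (fun j => alt R k j * ext_weight R S j / r ^+ j) M.+1).
      by apply/funext => M; rewrite /series /= big_mkord.
    rewrite (cvg_shiftS (series _)); exact: (@is_cvg_geometric_fact _ _ _ r alt_weight_le).
  have -> : (fun M => partial_alt M.+1)
      = (fun M => series (fun j => alt R k j / j`!%:R / r ^+ j) M.+1).
    by apply/funext => M; rewrite /series /= big_mkord.
  rewrite (cvg_shiftS (series _)); apply: (@is_cvg_geometric_fact _ _ 1 r) => j.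
  by rewrite normrM normfV normr_nat ler_wpM2r ?invr_ge0 ?norm_alt_le1.
by rewrite (cvg_unique _ u_L u_W) // Z0 mulr0 subr0.
Unshelve. all: by end_near. Qed.

End Value.
End Phi.

(** * Asymptotics *)

(** The rate is enlarged to be positive and the constant to cover the finitely many
    initial terms, so that later estimates hold for every [n]. *)
Lemma EKP_geometric (R : realType) k (r : R) : is_EKP_constant k r ->
  exists c E gam : R, [/\ 0 < c, 0 < gam, gam < 1 &
    forall n, `|avoid_prob R k n - c * r ^+ n| <= E * (r * gam) ^+ n].
Proof.
case=> r_gt0 [c [g [c_gt0 g_ge0 g_lt1 [e /eqO_exP[K K_gt0 [N _ e_le]] f_eq]]]].
pose gam := Num.max g 2^-1.
have gam_gt0 : 0 < gam by rewrite lt_max invr_gt0 ltr0n orbT.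
have gam_lt1 : gam < 1 by rewrite gt_max g_lt1 invf_lt1 ?ltr1n.
pose M : R := K + \sum_(i < N) `|e i| / gam ^+ i.
have sum_ge0 : 0 <= \sum_(i < N) `|e i| / gam ^+ i.
  by apply: sumr_ge0 => i _; rewrite divr_ge0 ?exprn_ge0 // ltW.
have e_M n : `|e n| <= M * gam ^+ n.
  have gn_ge0 : 0 <= gam ^+ n by rewrite exprn_ge0 // ltW.
  have [lt_n|le_n] := ltnP n N.
    apply: (@le_trans _ _ (`|e n| / gam ^+ n * gam ^+ n)).
      by rewrite divfK // expf_neq0 // lt0r_neq0.
    rewrite ler_wpM2r // /M (bigD1 (Ordinal lt_n)) //=.
    rewrite addrCA lerDl addr_ge0 ?(ltW K_gt0) // sumr_ge0 // => i _.
    by rewrite divr_ge0 ?exprn_ge0 // ltW.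
  apply: le_trans (e_le _ le_n) _; rewrite ger0_norm ?exprn_ge0 //.
  apply: ler_pM; [exact: ltW | exact: exprn_ge0 | by rewrite lerDl |].
  by rewrite lerXn2r ?nnegrE // ?(ltW gam_gt0) // le_max lexx.
exists c, (c * M), gam; split => // n.
rewrite /avoid_prob f_eq.
have -> : n`!%:R * c * r ^+ n * (1 + e n) / n`!%:R - c * r ^+ n = c * r ^+ n * e n.
  by have h := fact_neq0 R n; field.
rewrite normrM ger0_norm ?mulr_ge0 ?exprn_ge0 ?(ltW c_gt0) ?(ltW r_gt0) // exprMn.
have -> : c * M * (r ^+ n * gam ^+ n) = c * r ^+ n * (M * gam ^+ n) by ring.
by rewrite ler_wpM2l // ltW // mulr_gt0 // exprn_gt0.
Qed.

Lemma cvg_geometric_ratio (R : realType) (u : nat -> R) (l r gam K : R) :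
  0 < r -> 0 < gam -> gam < 1 ->
  (forall n, `|u n - l * r ^+ n| <= K * (r * gam) ^+ n) ->
  (fun n => u n / r ^+ n) @ \oo --> l.
Proof.
move=> r_gt0 gam_gt0 gam_lt1 u_le.
have K_cvg : (fun n => K * gam ^+ n) @ \oo --> (0 : R).
  rewrite -(mulr0 K); apply: cvgM; first exact: cvg_cst.
  by apply: cvg_expr; rewrite ger0_norm ?ltW.
apply/cvgrPdist_le => e e_gt0; near=> n.
apply: (@le_trans _ _ (K * gam ^+ n)); last first.
  by near: n; exact: (cvgr_le _ K_cvg _ e_gt0).
have rn_gt0 : 0 < r ^+ n by rewrite exprn_gt0.
rewrite -(ler_pM2r rn_gt0) -{2}(gtr0_norm rn_gt0) -normrM mulrBl divfK ?gt_eqF //.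
by rewrite distrC -mulrA [gam ^+ n * _]mulrC -exprMn; exact: u_le.
Unshelve. all: by end_near. Qed.

(** n gam^n is at most 1 + gam + ... + gam^(n - 1), hence bounded. *)
Lemma geometric_powR_le (R : realType) (gam : R) n : 0 < gam -> gam < 1 ->
  (0 < n)%N -> gam ^+ n <= (1 - gam)^-1 * n%:R `^ (- (49%:R / 100%:R)).
Proof.
move=> gam_gt0 gam_lt1 n_gt0.
have sum_ge : n%:R * gam ^+ n <= (1 - gam)^-1.
  rewrite -[leRHS]mul1r ler_pdivlMr ?subr_gt0 //.
  apply: (@le_trans _ _ ((\sum_(i < n) gam ^+ i) * (1 - gam))).
    rewrite ler_wpM2r ?subr_ge0 ?(ltW gam_lt1) // mulr_natl.
    rewrite -[X in _ *+ X]card_ord -sumr_const ler_sum // => i _.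
    by rewrite ler_wiXn2l ?(ltW gam_gt0) ?(ltW gam_lt1) // ltnW.
  rewrite mulrC -opprB mulNr -subrX1 opprB gerBl exprn_ge0 //; exact: ltW.
have n_gt0R : 0 < n%:R :> R by rewrite ltr0n.
apply: (@le_trans _ _ ((1 - gam)^-1 * n%:R^-1)).
  by rewrite ler_pdivlMr // mulrC.
rewrite ler_wpM2l ?invr_ge0 ?subr_ge0 ?(ltW gam_lt1) // -powR_inv1 ?(ltW n_gt0R) //.
by apply: ler_powR; [rewrite ler1n | lra].
Qed.

Section Asymptotics.
Variables (R : realType) (k : nat) (r c E gam : R).
Hypotheses (r_gt0 : 0 < r) (c_gt0 : 0 < c) (gam_gt0 : 0 < gam) (gam_lt1 : gam < 1).
Hypothesis p_asymp : forall n,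
  `|avoid_prob R k n - c * r ^+ n| <= E * (r * gam) ^+ n.
Hypothesis k_ge3 : (2 < k)%N.
Let k_gt1 : (1 < k)%N := ltnW k_ge3.

(** The convolution of f_k(n) / n! with alt_j / j! vanishes for n >= 1, while it is
    asymptotic to [c r^n] times this value. *)
Lemma alt_series_eq0 :
  limn (series (fun j => alt R k j / j`!%:R / r ^+ j)) = 0.
Proof.
have b_le j : `|alt R k j / j`!%:R| <= 1 / j`!%:R.
  by rewrite normrM normfV normr_nat ler_wpM2r ?invr_ge0 ?norm_alt_le1.
have := geometric_convolution (ltW c_gt0) r_gt0 gam_gt0 gam_lt1 p_asymp b_le.
set Z := limn _; set K := _ * expR _ => tr.
pose u m := \sum_(j < m.+1) alt R k j / j`!%:R * avoid_prob R k (m - j).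
have u_cvg : (fun m => u m / r ^+ m) @ \oo --> c * Z.
  apply: (cvg_geometric_ratio (K := K) r_gt0 gam_gt0 gam_lt1) => m.
  by rewrite mulrAC; exact: tr.
have u_cvg0 : (fun m => u m / r ^+ m) @ \oo --> (0 : R).
  rewrite -cvg_shiftS (_ : (fun m => _) = cst 0); first exact: cvg_cst.
  by apply/funext => m /=; rewrite /u avoid_prob_recurrence // mul0r.
have cZ0 : c * Z = 0 by apply: (cvg_unique _ u_cvg u_cvg0).
move/eqP: cZ0; rewrite mulf_eq0 (gt_eqF c_gt0) /=.
by move/eqP.
Qed.

Section Main.
Variables (I : {fset nat}).
Hypotheses (I_neq0 : I != fset0) (I_gt0 : forall i : nat, i \in I -> (0 < i)%N).
Let t := (\max_(i <- I) i + k - 1)%N.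
Let S := descperms k I t.

Lemma t_gt0 : (0 < t)%N.
Proof. by rewrite /t; move: (\max_(i <- I) i) => M; lia. Qed.

Let W := limn (series (fun j => alt R k j * ext_weight R S j / r ^+ j)).
Let d_prob m : R := \sum_(j < m.+1) alt R k j * ext_weight R S j * avoid_prob R k (m - j).

Lemma d_prob_asymp : exists K : R, forall m,
  `|d_prob m - c * W * r ^+ m| <= K * (r * gam) ^+ m.
Proof.
have := geometric_convolution (ltW c_gt0) r_gt0 gam_gt0 gam_lt1 p_asymp (@alt_weight_le R k t S t_gt0).
rewrite -/W; set K := _ * expR _ => tr.
by exists K => m; rewrite mulrAC; exact: tr.
Qed.

Lemma avoid_prob_ratio : (fun m => avoid_prob R k m / r ^+ m) @ \oo --> c.
Proof. exact: cvg_geometric_ratio r_gt0 gam_gt0 gam_lt1 p_asymp. Qed.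

Lemma d_prob_ratio : (fun m => d_prob m / r ^+ m) @ \oo --> c * W.
Proof.
have [K d_le] := d_prob_asymp.
exact: cvg_geometric_ratio r_gt0 gam_gt0 gam_lt1 d_le.
Qed.

Lemma d_fact_prob m : (d k I (m + t))%:R = (m + t)`!%:R * d_prob m.
Proof. by apply: d_weight => //; exact: t_gt0. Qed.

(** Positivity of the main term, without which an additive error would not be a
    relative one.  The permutation tau is prolonged to length [T] by new
    maxima followed by a new minimum: its run set is still [I], and the sieve
    bound C 0 >= A 0 - A 1 for such prefixes is, in the limit, a positive multiple
    of r - 1 / (T + 1), which is positive once T is large. *)
Lemma W_gt0 : S != finset.set0 -> 0 < W.
Proof.
case/set0Pn => tau; rewrite inE => /eqP tauI.
have [q T_large] : exists q : nat, r^-1 < (q.+2 + t).+1%:R.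
  exists (Num.truncn r^-1); apply: lt_le_trans (truncnS_gt _) _.
  by rewrite ler_nat ltnS; do 2!apply: leqW; exact: leq_addr.
have := ex_descset_last_min k_ge3 t_gt0 tauI q.
have [T T_def] : exists T, T = (q.+2 + t)%N by exists (q.+2 + t)%N.
move: T_large; rewrite -T_def => T_large [v [vI v0]].
pose S' := [set v : 'S_T | (descset k v == I) && (lastrank v == 0%N)]%SET.
have S'I : S' \subset descperms k I T.
  by apply/fintype.subsetP => w; rewrite !inE => /andP[].
have S'0 w : w \in S' -> lastrank w = 0%N by rewrite inE => /andP[_ /eqP].
have S'_gt0 : (0 < #|S'|)%N.
  by apply/card_gt0P; exists v; rewrite inE vI v0 !eqxx.
pose a : R := #|S'|%:R / T`!%:R.
have a_gt0 : 0 < a by rewrite divr_gt0 ?ltr0n ?fact_gt0.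
pose P m := avoid_prob R k m / r ^+ m.
have T_gt0 : (0 < T)%N by rewrite T_def.
have d_ge m : a * (P m.+1 * r - P m / T.+1%:R)
    <= d_prob (m + q.+3) / r ^+ (m + q.+3) * r ^+ q.+3.
  have rm_gt0 : 0 < r ^+ m by rewrite exprn_gt0.
  have := d_weight_ge R m k_gt1 T_gt0 S'I S'0.
  have -> : (m.+1 + T = m + q.+3 + t)%N by rewrite T_def !addnS !addSn addnA.
  rewrite d_fact_prob ler_pM2l ?ltr0n ?fact_gt0 // -(ler_pM2r (_ : 0 < (r ^+ m)^-1)) ?invr_gt0 //.
  have h1 := lt0r_neq0 r_gt0; have h2 := lt0r_neq0 rm_gt0.
  have h3 : r ^+ q.+3 != 0 by rewrite expf_neq0.
  congr (_ <= _); rewrite /P /a.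
    have := fact_neq0 R T; have : T.+1%:R != 0 :> R by rewrite pnatr_eq0.
    move=> h4 h5; rewrite exprS; field.
    by rewrite h1 h2 h5 nat1r h4.
  by rewrite exprD; field; rewrite h2 h3.
have rhs_cvg : (fun m => d_prob (m + q.+3) / r ^+ (m + q.+3) * r ^+ q.+3) @ \oo
    --> c * W * r ^+ q.+3.
  apply: cvgM; last exact: cvg_cst.
  by have := d_prob_ratio; rewrite -(cvg_shiftn q.+3).
have lhs_cvg : (fun m => a * (P m.+1 * r - P m / T.+1%:R)) @ \oo
    --> a * (c * r - c / T.+1%:R).
  apply: cvgM; first exact: cvg_cst.
  apply: cvgB; (apply: cvgM; last exact: cvg_cst).
    by have := avoid_prob_ratio; rewrite -cvg_shiftS.
  exact: avoid_prob_ratio.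
have le_lim : a * (c * r - c / T.+1%:R) <= c * W * r ^+ q.+3.
  by apply: (ler_cvg_to lhs_cvg rhs_cvg); near=> m; exact: d_ge.
have T1_gt0 : 0 < T.+1%:R :> R by rewrite ltr0n.
have gap : 0 < a * (c * r - c / T.+1%:R).
  rewrite mulr_gt0 // -mulrBr mulr_gt0 // subr_gt0.
  by rewrite -[ltRHS]invrK ltf_pV2 ?posrE ?invr_gt0.
have := lt_le_trans gap le_lim.
by rewrite pmulr_lgt0 ?exprn_gt0 // pmulr_rgt0.
Unshelve. all: by end_near. Qed.

Let L := t`!%:R * W.

(** Both d_k(I, m + t), suitably normalized, and [L] times f_k(m) / m! equal
    c r^m L up to O((r gam)^m), and the latter is at least of order r^m. *)
Lemma relative_error : S != finset.set0 -> exists K : R,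
  \forall m \near \oo, 0 < avoid_prob R k m /\
   `|t`!%:R * d_prob m / (avoid_prob R k m * L) - 1| <= K * gam ^+ m.
Proof.
move=> S_neq0; have W_gt0 := W_gt0 S_neq0.
have [K d_le] := d_prob_asymp.
exists ((K + E * W) / (c / 2 * W)).
have c2 : c / 2 < c by rewrite ltr_pdivrMr // ltr_pMr // ltr1n.
have near_p := cvgr_gt _ avoid_prob_ratio _ c2.
near=> m.
have rm_gt0 : 0 < r ^+ m by rewrite exprn_gt0.
have p_gt : c / 2 * r ^+ m < avoid_prob R k m.
  by rewrite -ltr_pdivlMr //; near: m; exact: near_p.
have p_gt0 : 0 < avoid_prob R k m.
  by apply: le_lt_trans p_gt; rewrite mulr_ge0 ?divr_ge0 ?(ltW c_gt0) ?(ltW rm_gt0).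
split => //.
have h1 := lt0r_neq0 p_gt0; have h2 := lt0r_neq0 W_gt0; have h3 := fact_neq0 R t.
have -> : t`!%:R * d_prob m / (avoid_prob R k m * L) - 1
  = (d_prob m - avoid_prob R k m * W) / (avoid_prob R k m * W).
  by rewrite /L; field; rewrite h1 h2 h3.
have pW_gt0 : 0 < avoid_prob R k m * W by rewrite mulr_gt0.
rewrite normrM normfV (gtr0_norm pW_gt0) ler_pdivrMr //.
have num_le : `|d_prob m - avoid_prob R k m * W| <= (K + E * W) * (r * gam) ^+ m.
  have -> : d_prob m - avoid_prob R k m * W
    = (d_prob m - c * W * r ^+ m) - (avoid_prob R k m - c * r ^+ m) * W by ring.
  apply: le_trans (ler_normB _ _) _; rewrite [leRHS]mulrDl; apply: lerD => //.
  rewrite normrM (gtr0_norm W_gt0) mulrAC ler_wpM2r ?(ltW W_gt0) //.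
apply: le_trans num_le _.
have K_ge0 : 0 <= K + E * W.
  have E_ge0 : 0 <= E by have := le_trans (normr_ge0 _) (p_asymp 0); rewrite expr0 mulr1.
  have K_ge0 : 0 <= K by have := le_trans (normr_ge0 _) (d_le 0%N); rewrite expr0 mulr1.
  by rewrite addr_ge0 // mulr_ge0 // ltW.
have -> : (K + E * W) * (r * gam) ^+ m
  = (K + E * W) / (c / 2 * W) * gam ^+ m * (c / 2 * r ^+ m * W).
  by rewrite exprMn; have := lt0r_neq0 c_gt0 => h4; field; rewrite h2 h4.
apply: ler_wpM2l.
  by rewrite mulr_ge0 ?exprn_ge0 ?(ltW gam_gt0) // divr_ge0 // ltW // mulr_gt0 // divr_gt0.
by rewrite ler_wpM2r ?(ltW W_gt0) // ltW.
Unshelve. all: by end_near. Qed.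

Lemma d_relative_asymptotics :
  exists2 e : nat -> R^o,
    e =O_\oo (fun n : nat => n%:R `^ (- (49%:R / 100%:R)) : R^o) &
    \forall n \near \oo,
      (d k I n)%:R = (1 + e n) * (('C(n, t))%:R * (f k (n - t))%:R * L).
Proof.
have dC n : (t <= n)%N ->
    (d k I n)%:R = 'C(n, t)%:R * (n - t)`!%:R * (t`!%:R * d_prob (n - t)) :> R.
  move=> le_tn; rewrite -{1}(subnK le_tn) d_fact_prob subnK // -(bin_fact le_tn) !natrM.
  by ring.
(* [S] can be empty: runs starting at 1 and 3 force one starting at 2 if k = 3.
   Both sides are then zero. *)
have [S0|S_neq0] := eqVneq S finset.set0.
  have w0 j : ext_weight R S j = 0 by rewrite /ext_weight S0 big_set0 mul0r.
  have d0 m : d_prob m = 0.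
    by rewrite /d_prob big1 // => j _; rewrite w0 mulr0 mul0r.
  have L0 : L = 0.
    have u0 : (fun m => d_prob m / r ^+ m) @ \oo --> (0 : R).
      rewrite (_ : (fun m => _) = cst 0); first exact: cvg_cst.
      by apply/funext => m; rewrite d0 mul0r.
    have cW0 : c * W = 0 by apply: (cvg_unique _ d_prob_ratio u0).
    move/eqP: cW0; rewrite mulf_eq0 (gt_eqF c_gt0) /=.
    by rewrite /L => /eqP ->; rewrite mulr0.
  exists (fun=> 0); last first.
    near=> n; rewrite dC ?d0 ?L0 ?mulr0 //.
    by near: n; exact: nbhs_infty_ge.
  apply/eqO_exP; exists 1 => //; near=> n.
  by rewrite normr0 mulr_ge0.
have [K near_e] := relative_error S_neq0.
have near_e' : \forall n \near \oo, 0 < avoid_prob R k (n - t) /\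
   `|t`!%:R * d_prob (n - t) / (avoid_prob R k (n - t) * L) - 1| <= K * gam ^+ (n - t).
  case: near_e => N _ HN; exists (N + t)%N => // n /= le_n.
  by apply: HN => /=; rewrite leq_subRL //; lia.
exists (fun n => t`!%:R * d_prob (n - t) / (avoid_prob R k (n - t) * L) - 1).
  apply/eqO_exP; exists (`|K| / gam ^+ t / (1 - gam) + 1).
    by rewrite ltr_pwDr // !divr_ge0 ?exprn_ge0 ?subr_ge0 ?(ltW gam_gt0) ?(ltW gam_lt1).
  near=> n.
  have le_tn : (t <= n)%N by near: n; exact: nbhs_infty_ge.
  have n_gt0 : (0 < n)%N by near: n; exact: nbhs_infty_gt.
  have [_ e_le] : 0 < avoid_prob R k (n - t) /\
   `|t`!%:R * d_prob (n - t) / (avoid_prob R k (n - t) * L) - 1| <= K * gam ^+ (n - t).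
    by near: n; exact: near_e'.
  apply: le_trans e_le _; rewrite (ger0_norm (powR_ge0 _ _)).
  have gt_neq0 : gam ^+ t != 0 by rewrite expf_neq0 // lt0r_neq0.
  have gt_ge0 : 0 <= gam ^+ t by rewrite exprn_ge0 // ltW.
  have -> : K * gam ^+ (n - t) = K / gam ^+ t * gam ^+ n.
    by rewrite -[in gam ^+ n](subnK le_tn) exprD; field.
  apply: (@le_trans _ _ (`|K| / gam ^+ t * gam ^+ n)).
    rewrite ler_wpM2r ?exprn_ge0 ?(ltW gam_gt0) //.
    by rewrite ler_wpM2r ?invr_ge0 // ler_norm.
  apply: (@le_trans _ _ (`|K| / gam ^+ t / (1 - gam) * n%:R `^ (- (49%:R / 100%:R)))).
    rewrite -[leRHS]mulrA ler_wpM2l ?divr_ge0 //; exact: geometric_powR_le.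
  by rewrite ler_wpM2r ?powR_ge0 // lerDl.
near=> n.
have le_tn : (t <= n)%N by near: n; exact: nbhs_infty_ge.
have [p_gt0 _] : 0 < avoid_prob R k (n - t) /\
   `|t`!%:R * d_prob (n - t) / (avoid_prob R k (n - t) * L) - 1| <= K * gam ^+ (n - t).
  by near: n; exact: near_e'.
have L_neq0 : L != 0 by rewrite mulf_neq0 ?fact_neq0 ?lt0r_neq0 ?W_gt0.
rewrite dC // f_avoid_prob addrC subrK.
by have := lt0r_neq0 p_gt0 => h; field; rewrite h L_neq0.
Unshelve. all: by end_near. Qed.

End Main.
End Asymptotics.

Theorem theorem5p4 (R : realType) (k : nat) (I : {fset nat}) (r : R)
    (k_ge3 : (3 <= k)%N) (I_neq0 : I != fset0)
    (I_gt0 : forall i : nat, i \in I -> (0 < i)%N)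
    (r_EKP : is_EKP_constant k r) :
  let t := (\max_(i <- I) i + k - 1)%N in
  exists2 e : nat -> R^o,
    e =O_\oo (fun n : nat => n%:R `^ (- (49%:R / 100%:R)) : R^o) &
    \forall n \near \oo,
      (d k I n)%:R =
      (1 + e n) * (('C(n, t))%:R * (f k (n - t))%:R *
        \int[lebesgue_measure]_(x in `[0, 1])
          (phi k r x *
           \int[lebesgue_measure]_(y in `[0, x])
             \sum_(tau in descperms k I t) Phi t (letter tau t) y)).
Proof.
move=> t; have r_gt0 : 0 < r := proj1 r_EKP.
have [c [E [gam [c_gt0 gam_gt0 gam_lt1 p_asymp]]]] := EKP_geometric r_EKP.
have t_gt0 : (0 < t)%N by rewrite /t; move: (\max_(i <- I) i) => M; lia.
rewrite integral_value //; last exact: (alt_series_eq0 r_gt0 c_gt0 gam_gt0 gam_lt1 p_asymp).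
exact: (d_relative_asymptotics r_gt0 c_gt0 gam_gt0 gam_lt1 p_asymp).
Qed.
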